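(* Let $f:M\to M$ be $H_1$-expanding, with action $A$ on $H_1(M;\mathbb{Z})\cong\mathbb{Z}^b$, and let $\tilde f$ be a lift of $f$ to the universal Abelian cover $\tilde M_a$. Then for every $\tilde x\in\tilde M_a$, $$\lim_{k\to\infty}(A^k-I)^{-1}d_k(\tilde x)=\tilde\beta(\tilde x),$$ where $d_k(\tilde x)=\lfloor\tilde f^k(\tilde x)\rfloor-\lfloor\tilde x\rfloor\in\mathbb{Z}^b$ and $\tilde\beta(\tilde x)=\lim_{n\to\infty}A^{-n}\,\tilde\iota(\tilde f^n(\tilde x))$.
   Context: Setting: $M$ is a smooth, connected, orientable, compact (Riemannian) manifold with $H_1(M;\mathbb{Z})\cong\mathbb{Z}^b$ torsion-free, $b>0$, and $f:M\to M$ is continuous, onto and orientation preserving. $A=f_*:H_1(M;\mathbb{Z})\to H_1(M;\mathbb{Z})$ is the induced map, viewed as a $b\times b$ integer matrix. The universal Abelian cover $\pi:\tilde M_a\to M$ is the quotient of the universal cover by the commutator subgroup of $\pi_1(M)$; its deck group is $\mathbb{Z}^b=H_1(M;\mathbb{Z})$, with $\delta_{\vec n}$ the deck transformation of $\vec n$. Every $f$ lifts to $\tilde f:\tilde M_a\to\tilde M_a$, and $\tilde f\circ\delta_{\vec n}=\delta_{A\vec n}\circ\tilde f$. The map $\tilde\iota$: choose a basis $\Gamma_1,\dots,\Gamma_b$ of $H_1(M;\mathbb{Z})$ and a dual basis $\omega_1,\dots,\omega_b$ of harmonic one-forms for $H^1_{DR}(M;\mathbb{R})$, $\omega_i(\Gamma_j)=\delta_{ij}$;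 lift them to $\tilde\omega_i$ on $\tilde M_a$, fix $\tilde x_0\in\tilde M_a$, and set $\tilde\iota(\tilde x)=\left(\int_\gamma\tilde\omega_1,\dots,\int_\gamma\tilde\omega_b\right)\in\mathbb{R}^b$ for any smooth path $\gamma$ from $\tilde x_0$ to $\tilde x$. Then $\tilde\iota\circ\delta_{\vec n}=\tilde\iota+\vec n$. $f$ is $H_1$-expanding if all eigenvalues of $A$ lie outside the closed unit disk; in this case the limit defining $\tilde\beta$ exists (uniformly in $\tilde x$) and $\tilde\beta:\tilde M_a\to\mathbb{R}^b$ is continuous. Integer part: let $\tilde M_0\subset\tilde M_a$ be a connected fundamental domain for the $\mathbb{Z}^b$-action by deck transformations, with $\tilde\iota(\tilde M_0)$ bounded, and let $\tilde M_{\vec n}=\delta_{\vec n}\tilde M_0$, so that $\tilde M_a=\bigsqcup_{\vec n\in\mathbb{Z}^b}\tilde M_{\vec n}$ as a disjoint union. For $\tilde x\in\tilde M_a$ let $\lfloor\tilde x\rfloor=\vec n$ when $\tilde x\in\tilde M_{\vec n}$. *)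

(* Defs.v *)
From HB Require Import structures.
From mathcomp Require Import all_boot all_order all_algebra.
From mathcomp Require Import all_classical all_reals all_analysis.
From mathcomp Require Import complex.

Set Implicit Arguments.
Unset Strict Implicit.
Unset Printing Implicit Defensive.

Import Order.TTheory GRing.Theory Num.Theory numFieldNormedType.Exports.
Local Open Scope classical_set_scope.
Local Open Scope ring_scope.

(* Class C^k on an open set [D]; [f] is irrelevant outside [D]. *)
Fixpoint Ck (R : realType) (V W : normedModType R) (k : nat) (D : set V)
    (f : V -> W) : Prop :=
  match k with
  | 0 => forall x, D x -> {for x, continuous f}
  | k'.+1 => (forall x, D x -> differentiable f x) /\
             forall v, Ck k' D (fun x => 'D_v f x)
  end.

Definition smooth_on (R : realType) (V W : normedModType R) (D : set V)
    (f : V -> W) : Prop :=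
  forall k, Ck k D f.

Record chart (R : realType) (m : nat) (M : topologicalType) := Chart {
  dom : set M;
  cmap : M -> 'rV[R]_m;
  cinv : 'rV[R]_m -> M;
  dom_open : open dom;
  cod_open : open (cmap @` dom);
  cmapK : forall x, dom x -> cinv (cmap x) = x;
  cmap_continuous : forall x, dom x -> {for x, continuous cmap};
  cinv_continuous : forall u, (cmap @` dom) u -> {for u, continuous cinv} }.

Definition cod (R : realType) (m : nat) (M : topologicalType)
  (phi : chart R m M) : set 'rV[R]_m := cmap phi @` dom phi.

Definition overlap (R : realType) (m : nat) (M : topologicalType)
  (phi psi : chart R m M) : set 'rV[R]_m := cmap phi @` (dom phi `&` dom psi).

Definition transition (R : realType) (m : nat) (M : topologicalType)
  (phi psi : chart R m M) : 'rV[R]_m -> 'rV[R]_m := cmap psi \o cinv phi.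

(* [chart_at] only serves to compute chart-independent quantities. *)
Record smooth_atlas (R : realType) (m : nat) (M : topologicalType) :=
  SmoothAtlas {
  charts : set (chart R m M);
  chart_at : M -> chart R m M;
  chart_at_charts : forall x, charts (chart_at x);
  dom_chart_at : forall x, dom (chart_at x) x;
  smooth_transition : forall phi psi, charts phi -> charts psi ->
    smooth_on (overlap phi psi) (transition phi psi) }.

(* There is an atlas of the same smooth structure whose transition maps have
   positive Jacobian determinants. *)
Definition orientable (R : realType) (m : nat) (M : topologicalType)
    (S : smooth_atlas R m M) : Prop :=
  exists O : set (chart R m M),
    [/\ (forall x, exists2 phi, O phi & dom phi x),
        (forall phi psi, O phi -> charts S psi ->
          smooth_on (overlap phi psi) (transition phi psi) /\
          smooth_on (overlap psi phi) (transition psi phi)),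
        (forall phi psi, O phi -> O psi ->
          smooth_on (overlap phi psi) (transition phi psi)) &
        (forall phi psi u, O phi -> O psi -> overlap phi psi u ->
          0 < \det (jacobian (transition phi psi) u))].

(* In every chart tangent vectors are rows, so that the derivative of a map
   acts by [v |-> v *m jacobian], and covectors are columns. *)

Definition metric_tensor (R : realType) (m : nat) (M : topologicalType) :=
  chart R m M -> 'rV[R]_m -> 'M[R]_m.

Definition is_riemannian (R : realType) (m : nat) (M : topologicalType)
    (S : smooth_atlas R m M) (g : metric_tensor R m M) : Prop :=
  (forall phi, charts S phi ->
    [/\ smooth_on (cod phi) (g phi),
        (forall u, cod phi u -> (g phi u)^T = g phi u) &
        (forall u (v : 'rV[R]_m), cod phi u -> v != 0 ->
          0 < (v *m g phi u *m v^T) 0 0)]) /\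
  (forall phi psi u, charts S phi -> charts S psi -> overlap phi psi u ->
    let J := jacobian (transition phi psi) u in
    g phi u = J *m g psi (transition phi psi u) *m J^T).

Definition one_form (R : realType) (m : nat) (M : topologicalType) :=
  chart R m M -> 'rV[R]_m -> 'cV[R]_m.

Definition is_one_form (R : realType) (m : nat) (M : topologicalType)
    (S : smooth_atlas R m M) (w : one_form R m M) : Prop :=
  (forall phi, charts S phi -> smooth_on (cod phi) (w phi)) /\
  (forall phi psi u, charts S phi -> charts S psi -> overlap phi psi u ->
    w phi u = jacobian (transition phi psi) u *m w psi (transition phi psi u)).

Definition partial (R : realType) (m : nat) (i : 'I_m) (h : 'rV[R]_m -> R)
  (u : 'rV[R]_m) : R := 'D_(delta_mx 0 i : 'rV[R]_m) h u.

Definition closed_form (R : realType) (m : nat) (M : topologicalType)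
    (S : smooth_atlas R m M) (w : one_form R m M) : Prop :=
  is_one_form S w /\
  forall phi u i j, charts S phi -> cod phi u ->
    partial i (fun v => w phi v j 0) u = partial j (fun v => w phi v i 0) u.

(* d^* w = 0, by the local formula
   - d^* w = (det g)^(-1/2) \sum_i d_i ((det g)^(1/2) \sum_j g^{ij} w_j). *)
Definition coclosed_form (R : realType) (m : nat) (M : topologicalType)
    (S : smooth_atlas R m M) (g : metric_tensor R m M) (w : one_form R m M)
    : Prop :=
  forall phi u, charts S phi -> cod phi u ->
    \sum_(i < m) partial i (fun v =>
      Num.sqrt (\det (g phi v)) * (invmx (g phi v) *m w phi v) i 0) u = 0.

Definition harmonic_form (R : realType) (m : nat) (M : topologicalType)
    (S : smooth_atlas R m M) (g : metric_tensor R m M) (w : one_form R m M)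
    : Prop :=
  closed_form S w /\ coclosed_form S g w.

Definition exact_form (R : realType) (m : nat) (M : topologicalType)
    (S : smooth_atlas R m M) (w : one_form R m M) : Prop :=
  exists h : M -> R, forall phi, charts S phi ->
    smooth_on (cod phi) (h \o cinv phi) /\
    forall u, cod phi u -> w phi u = \col_i partial i (h \o cinv phi) u.

(* The classes of the closed forms [w i] are a basis of H^1_DR(M;R). *)
Definition deRham_basis (R : realType) (m b : nat) (M : topologicalType)
    (S : smooth_atlas R m M) (w : 'I_b -> one_form R m M) : Prop :=
  (forall i, closed_form S (w i)) /\
  forall z, closed_form S z -> exists! c : 'cV[R]_b,
    exact_form S (fun phi u => z phi u - \sum_(i < b) c i 0 *: w i phi u).

(* [gamma] restricts to a smooth path on [0, 1]: it is smooth on a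
   neighbourhood of each point of [0, 1], endpoints included. *)
Definition smooth_path (R : realType) (m : nat) (M : topologicalType)
    (S : smooth_atlas R m M) (gamma : R -> M) : Prop :=
  forall t : R, 0 <= t <= 1 -> exists (phi : chart R m M) (J : set R),
    [/\ charts S phi, open J, J t, gamma @` J `<=` dom phi &
        smooth_on J (cmap phi \o gamma)].

Definition path_integral (R : realType) (m : nat) (M : topologicalType)
    (S : smooth_atlas R m M) (w : one_form R m M) (gamma : R -> M) : R :=
  \int[@lebesgue_measure R]_(t in `[0, 1])
    (let phi := chart_at S (gamma t) in
     (derive1 (cmap phi \o gamma) t *m w phi (cmap phi (gamma t))) 0 0).

Definition std_simplex (R : realType) (n : nat) : set 'rV[R]_n.+1 :=
  [set v | (forall i, 0 <= v 0 i) /\ \sum_i v 0 i = 1].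

(* The face inclusion of the standard n-simplex opposite to the vertex i. *)
Definition face (R : realType) (n : nat) (i : 'I_n.+2) (v : 'rV[R]_n.+1)
    : 'rV[R]_n.+2 :=
  \row_j (if unlift i j is Some k then v 0 k else 0).

(* A chain is a formal sum of integer multiples of simplices; the values of a
   simplex outside [std_simplex] are irrelevant. *)
Definition chain (R : realType) (n : nat) (M : topologicalType) :=
  seq (int * ('rV[R]_n.+1 -> M)).

Definition is_chain (R : realType) (n : nat) (M : topologicalType)
    (c : chain R n M) : Prop :=
  forall s, s \in c -> {within @std_simplex R n, continuous s.2}.

Definition coef (R : realType) (n : nat) (M : topologicalType)
    (c : chain R n M) (tau : 'rV[R]_n.+1 -> M) : int :=
  \sum_(p <- c | `[< forall v, std_simplex v -> p.2 v = tau v >]) p.1.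

Definition chain_eq (R : realType) (n : nat) (M : topologicalType)
    (c c' : chain R n M) : Prop :=
  forall tau, coef c tau = coef c' tau.

Definition scale_chain (R : realType) (n : nat) (M : topologicalType)
    (k : int) (c : chain R n M) : chain R n M :=
  [seq (k * p.1, p.2) | p <- c].

Definition push_chain (R : realType) (n : nat) (M N : topologicalType)
    (f : M -> N) (c : chain R n M) : chain R n N :=
  [seq (p.1, f \o p.2) | p <- c].

Definition boundary (R : realType) (n : nat) (M : topologicalType)
    (c : chain R n.+1 M) : chain R n M :=
  [seq ((-1) ^+ nat_of_ord i * p.1, p.2 \o @face R n i) | p <- c,
                                                  i <- enum 'I_n.+2].

Definition is_cycle (R : realType) (n : nat) (M : topologicalType)
    : chain R n M -> Prop :=
  match n with
  | 0 => fun c => is_chain c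
  | n'.+1 => fun c => is_chain c /\ chain_eq (boundary c) [::]
  end.

Definition homologous (R : realType) (n : nat) (M : topologicalType)
    (c c' : chain R n M) : Prop :=
  exists2 d : chain R n.+1 M, is_chain d & chain_eq c (c' ++ boundary d).

Definition lin_comb (R : realType) (n b : nat) (M : topologicalType)
    (k : 'cV[int]_b) (Gamma : 'I_b -> chain R n M) : chain R n M :=
  flatten [seq scale_chain (k i 0) (Gamma i) | i <- enum 'I_b].

(* The classes of the [Gamma i] are a basis of the abelian group H_n(M;Z),
   which is therefore isomorphic to Z^b. *)
Definition homology_basis (R : realType) (n b : nat) (M : topologicalType)
    (Gamma : 'I_b -> chain R n M) : Prop :=
  (forall i, is_cycle (Gamma i)) /\
  forall z : chain R n M, is_cycle z ->
    exists! k : 'cV[int]_b, homologous z (lin_comb k Gamma).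

(* Column j of [A] holds the coordinates of f_*[Gamma j]. *)
Definition induces (R : realType) (b : nat) (M : topologicalType)
    (Gamma : 'I_b -> chain R 1 M) (f : M -> M) (A : 'M[int]_b) : Prop :=
  forall j, homologous (push_chain f (Gamma j)) (lin_comb (col j A) Gamma).

Definition path_chain (R : realType) (M : topologicalType) (gamma : R -> M)
    : chain R 1 M :=
  [:: (1, fun v : 'rV[R]_2 => gamma (v 0 ord_max))].

(* f has positive degree on H_m(M;Z) = Z, where m = dim M. *)
Definition orientation_preserving (R : realType) (m : nat)
    (M : topologicalType) (f : M -> M) : Prop :=
  exists (mu : chain R m M) (d : int),
    [/\ is_cycle mu,
        (forall z : chain R m M, is_cycle z ->
          exists! k : int, homologous z (scale_chain k mu)),
        0 < d &
        homologous (push_chain f mu) (scale_chain d mu)].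

(* The i-th form takes the value delta_ij on the homology class of
   [Gamma j]. *)
Definition dual_to (R : realType) (m b : nat) (M : topologicalType)
    (S : smooth_atlas R m M) (w : 'I_b -> one_form R m M)
    (Gamma : 'I_b -> chain R 1 M) : Prop :=
  forall i j gamma, smooth_path S gamma -> gamma 0 = gamma 1 ->
    homologous (path_chain gamma) (Gamma j) ->
    path_integral S (w i) gamma = (i == j)%:R.

Definition cts_path (R : realType) (X : topologicalType) (gamma : R -> X)
    : Prop :=
  {within `[0, 1], continuous gamma}.

Definition simply_connected (R : realType) (X : topologicalType) : Prop :=
  (forall x y : X, exists gamma : R -> X,
    [/\ cts_path gamma, gamma 0 = x & gamma 1 = y]) /\
  (forall gamma : R -> X, cts_path gamma -> gamma 0 = gamma 1 ->
    exists H : R * R -> X,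
      [/\ {within `[0, 1] `*` `[0, 1], continuous H},
          (forall t, 0 <= t <= 1 -> H (t, 0) = gamma t),
          (forall t, 0 <= t <= 1 -> H (t, 1) = gamma 0) &
          (forall s, 0 <= s <= 1 -> H (0, s) = gamma 0 /\
                                 H (1, s) = gamma 0)]).

Definition covering (X B : topologicalType) (p : X -> B) : Prop :=
  [/\ continuous p,
      (forall y, exists x, p x = y) &
      (forall y, exists (W : set B) (sheets : set (set X)),
        [/\ open W, W y,
            p @^-1` W = \bigcup_(V in sheets) V,
            (forall V V', sheets V -> sheets V' -> V `&` V' !=set0 ->
              V = V') &
            (forall V, sheets V ->
              [/\ open V, p @` V = W,
                  (forall x x', V x -> V x' -> p x = p x' -> x = x') &
                  (forall U, open U -> U `<=` V -> open (p @` U))])])].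

Definition deck (X B : topologicalType) (p : X -> B) : set (X -> X) :=
  [set h | [/\ continuous h,
               exists2 k : X -> X, continuous k & cancel h k /\ cancel k h &
               forall x, p (h x) = p x]].

(* Finite products of commutators; inverses need no separate constructor, as
   the inverse of a commutator is a commutator. *)
Inductive deck_commutator (X B : topologicalType) (p : X -> B)
    : (X -> X) -> Prop :=
| deck_commutator_id : deck_commutator p idfun
| deck_commutator_mul (h a a' c c' : X -> X) :
    deck_commutator p h ->
    deck p a -> cancel a a' -> cancel a' a ->
    deck p c -> cancel c c' -> cancel c' c ->
    deck_commutator p (h \o (a \o c \o a' \o c')).

(* [p : U -> M] is the universal cover, on which pi_1(M) acts as the group of
   deck transformations, and [q] identifies [Ma], with the quotient topology,
   with the quotient of [U] by the commutator subgroup of this group. *)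
Definition universal_abelian_cover (R : realType) (U Ma M : topologicalType)
    (p : U -> M) (q : U -> Ma) (pi : Ma -> M) : Prop :=
  [/\ covering p /\ simply_connected R U,
      (forall u, pi (q u) = p u),
      (forall x, exists u, q u = x),
      (forall V : set Ma, open V <-> open (q @^-1` V)) &
      (forall u v, q u = q v <-> exists2 h, deck_commutator p h & v = h u)].

(* [delta] is the identification of Z^b = H_1(M;Z) with the deck group of
   [pi], which is simply transitive on the fibres: [delta n] is the deck
   transformation such that paths from x to [delta n x] project to loops of
   class \sum_i n_i Gamma_i. *)
Definition deck_iso (R : realType) (b : nat) (Ma M : topologicalType)
    (pi : Ma -> M) (Gamma : 'I_b -> chain R 1 M)
    (delta : 'cV[int]_b -> Ma -> Ma) : Prop :=
  [/\ (forall n, deck pi (delta n)) /\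
      (forall h, deck pi h -> exists! n, h = delta n),
      (forall n k x, delta (n + k) x = delta n (delta k x)),
      (forall x y, pi x = pi y -> exists n, y = delta n x) &
      (forall n x (gamma : R -> Ma), cts_path gamma -> gamma 0 = x ->
        gamma 1 = delta n x ->
        homologous (path_chain (pi \o gamma)) (lin_comb n Gamma))].

(* [iota] is integration from [x0] of the lifted forms. A path in the cover is
   smooth when its projection is, and the integral along it of a lifted
   (pulled back) form is the integral of the form along the projection. *)
Definition is_iota (R : realType) (m b : nat) (Ma M : topologicalType)
    (S : smooth_atlas R m M) (w : 'I_b -> one_form R m M) (pi : Ma -> M)
    (x0 : Ma) (iota : Ma -> 'cV[R]_b) : Prop :=
  forall x (gamma : R -> Ma), cts_path gamma -> smooth_path S (pi \o gamma) ->
    gamma 0 = x0 -> gamma 1 = x ->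
    forall i, iota x i 0 = path_integral S (w i) (pi \o gamma).

Definition fundamental_domain (b : nat) (Ma : topologicalType)
    (delta : 'cV[int]_b -> Ma -> Ma) (D : set Ma) : Prop :=
  connected D /\ forall x, exists! n, (delta n @` D) x.

Definition is_integer_part (b : nat) (Ma : topologicalType)
    (delta : 'cV[int]_b -> Ma -> Ma) (D : set Ma) (fl : Ma -> 'cV[int]_b)
    : Prop :=
  forall x, (delta (fl x) @` D) x.

Definition mxR (R : realType) (m n : nat) (A : 'M[int]_(m, n)) : 'M[R]_(m, n) :=
  map_mx intr A.

Definition H1_expanding (R : realType) (b : nat) (A : 'M[int]_b) : Prop :=
  forall z : R[i], eigenvalue (map_mx intr A : 'M[R[i]]_b) z -> 1 < `|z|.

(* Both the limit below and, for k >= 1, the inverse of A^k - I exist when [A]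
   is [H1_expanding], so the default values of [limn] and [invmx] play no
   role. *)
Definition tbeta (R : realType) (b : nat) (Ma : Type) (A : 'M[int]_b)
    (iota : Ma -> 'cV[R]_b) (tf : Ma -> Ma) (x : Ma) : 'cV[R]_b :=
  limn (fun n => invmx (mxR R A) ^+ n *m iota (iter n tf x)).

Definition displacement (b : nat) (Ma : Type) (fl : Ma -> 'cV[int]_b)
    (tf : Ma -> Ma) (k : nat) (x : Ma) : 'cV[int]_b :=
  fl (iter k tf x) - fl x.

(* Main.v *)
(* Integration along paths gives [iota (delta n x) = iota x + n], and naturality of homology gives
   [tf (delta n x) = delta (A n) (tf x)]; hence [iota \o tf - A iota] is invariant under deck
   transformations. Being locally bounded, it is bounded because M is compact. Since all
   eigenvalues of A lie outside the closed unit disk, [\sum_n |A^-n|] converges, so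
   [A^-n (iota (tf^n x))] converges by telescoping. As [iota - fl] is bounded, [A^-k d_k] has the
   same limit, and [(A^k - I)^-1 d_k = (I - A^-k)^-1 (A^-k d_k)] too because [A^-k] tends to 0. *)
Require Import Defs.
From HB Require Import structures.
From mathcomp Require Import all_boot all_order all_algebra.
From mathcomp Require Import all_classical all_reals all_analysis.
From mathcomp Require Import complex ring lra.

Set Implicit Arguments.
Unset Strict Implicit.
Unset Printing Implicit Defensive.

Import Order.TTheory GRing.Theory Num.Theory numFieldNormedType.Exports.
Local Open Scope classical_set_scope.
Local Open Scope ring_scope.

(** * Expanding matrices and displacements *)

(** Two obstacles shape the proof. The spectral hypothesis concerns complex eigenvalues, whereas the
    estimates use a norm of real matrices. Cayley-Hamilton bridges the gap: the entries of A^-n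
    satisfy a linear recurrence, resolved one characteristic root at a time, with multiplicity.
    Secondly, [is_iota] speaks only of smooth paths from [x0]: it contains independence of the path,
    but says nothing at a point that no smooth path reaches. Smooth paths between arbitrary points
    of the cover must therefore be constructed, and concatenated without losing smoothness. This is
    why paths are kept constant near their ends and why a smooth step is built from exp(-1/t). Short
    paths inside a chart also yield the local boundedness of [iota]. *)

Definition abs_summable (C : numDomainType) (v : nat -> C) :=
  exists K, forall N, \sum_(k < N) `|v k| <= K.

(** The relation gives |z| |v (k+1)| <= |v k| + |u (k+1)|. Summing, the tail T of the partial sum
    satisfies |z| T <= |v 0| + T + K, and |z| > 1 lets T be absorbed on the left. *)
Lemma abs_summable_recurrence (C : numFieldType) (z : C) (v u : nat -> C) :
  1 < `|z| -> (forall k, u k.+1 = v k - z * v k.+1) ->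
  abs_summable u -> abs_summable v.
Proof.
move=> z1 uv [K hK].
exists (`|v 0| + (`|v 0| + K) / (`|z| - 1)) => N.
have z0 : 0 < `|z| - 1 by rewrite subr_gt0.
have shrink (w : nat -> C) n : \sum_(k < n) `|w k| <= \sum_(k < n.+1) `|w k|.
  by rewrite big_ord_recr /= lerDl.
apply: le_trans (shrink v N) _; rewrite big_ord_recl lerD2l ler_pdivlMr//.
set T := (X in X * _ <= _).
have TE : \sum_(k < N.+1) `|v k| = `|v 0| + T by rewrite big_ord_recl.
have uK : \sum_(k < N) `|u k.+1| <= K.
  apply: le_trans (hK N.+1).
  by rewrite big_ord_recl lerDr.
have zT : T * `|z| <= (`|v 0| + T) + K.
  rewrite -TE; apply: le_trans (lerD (shrink v N) uK).
  rewrite -big_split mulr_suml; apply: ler_sum => k _.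
  rewrite /= uv -normrM -(mulrC z).
  by rewrite -[X in `|X| <= _](subKr (v k)) ler_normB.
by rewrite mulrBr mulr1 lerBlDr; rewrite addrAC in zT.
Qed.

Lemma expanding_unitmx (F : fieldType) n (A : 'M[F]_n) :
  ~~ eigenvalue A 0 -> A \in unitmx.
Proof.
move=> nA; rewrite -row_free_unit -kermx_eq0; apply/negPn/negP => kA.
have /rowV0Pn[i ki i0] := kA.
move/negP: nA; apply; apply/eigenvalueP; exists i.
  by rewrite scale0r; apply/sub_kermxP.
by [].
Qed.

Lemma summable_inv_exp (C : numClosedFieldType) n (A : 'M[C]_n.+1) :
  (forall z, eigenvalue A z -> 1 < `|z|) ->
  forall i j, abs_summable (fun k => (A^-1 ^+ k) i j).
Proof.
move=> hA i j.
have Au : A \is a GRing.unit.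
  by apply: expanding_unitmx; apply/negP => /hA; rewrite normr0 ltr10.
have [s ps] := closed_field_poly_normal (char_poly A).
have hs z : z \in s -> 1 < `|z|.
  move=> zs; apply: hA; rewrite eigenvalue_root_char ps rootZ ?root_prod_XsubC//.
  by rewrite lead_coef_eq0 -size_poly_eq0 size_char_poly.
(* Cayley-Hamilton; the linear factors are peeled off one at a time below. *)
have CH : horner_mx A (\prod_(z <- s) ('X - z%:P)) * 1 = 0.
  have := Cayley_Hamilton A; rewrite ps linearZ /= => /eqP.
  rewrite scaler_eq0 (monicP (char_poly_monic A)) oner_eq0 /= mulr1.
  by move/eqP.
have -> : (fun k => (A^-1 ^+ k) i j) = (fun k => (A^-1 ^+ k * 1) i j).
  by apply/funext => k; rewrite mulr1.
(* The identity is generalized to any Q killed by the product. The induction passes from Q to (A -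
   z) Q, and the entries u of A^-k (A - z) Q and v of A^-k Q satisfy u (k+1) = v k - z v (k+1). *)
move: {ps} (1 : 'M[C]_n.+1) CH.
elim: s hs => [|z s IH] hs Q.
  rewrite big_nil rmorph1 mul1r => ->; exists 0 => N.
  by rewrite big1// => k _; rewrite mulr0 mxE normr0.
rewrite big_cons mulrC rmorphM /= -mulrA => hQ.
have /IH : forall z, z \in s -> 1 < `|z| by move=> y ys; apply: hs; rewrite inE ys orbT.
move=> /(_ _ hQ); apply: abs_summable_recurrence (hs z (mem_head _ _)) _ => k.
rewrite rmorphB /= horner_mx_X horner_mx_C mulrBl mulrBr mxE [X in _ + X = _]mxE.
congr (_ + _).
  by rewrite exprSr -mulrA mulKr.
by rewrite -!mulmxE mul_scalar_mx -scalemxAr mxE.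
Qed.

Lemma mx_norm_entry (R : realType) m n (M : 'M[R]_(m, n)) i j : `|M i j| <= `|M|.
Proof.
rewrite [leRHS]/Num.norm /= mx_normrE.
by apply/bigmax_geP; right; exists (i, j).
Qed.

Lemma mx_norm_le (R : realType) m n (M : 'M[R]_(m, n)) (c : R) :
  0 <= c -> (forall i j, `|M i j| <= c) -> `|M| <= c.
Proof.
move=> c0 Mc; rewrite [leLHS]/Num.norm /= mx_normrE.
by apply/bigmax_leP; split => // -[i j] _ /=.
Qed.

(** The norm is the largest absolute value of an entry, so it is submultiplicative only up to the
    inner dimension; this is the origin of the factors [n.+1%:R] below. *)
Lemma mx_norm_mul (R : realType) m n p (M : 'M[R]_(m, n)) (N : 'M[R]_(n, p)) :
  `|M *m N| <= n%:R * `|M| * `|N|.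
Proof.
apply: mx_norm_le => [|i j]; first by rewrite !mulr_ge0// normr_ge0.
rewrite mxE; apply: le_trans (ler_norm_sum _ _ _) _.
rewrite -mulrA mulr_natl -[X in _ *+ X]card_ord -sumr_const.
apply: ler_sum => k _; rewrite normrM.
by apply: ler_pM; rewrite ?normr_ge0 ?mx_norm_entry.
Qed.

Lemma map_mxR_complex (R : realType) m n (A : 'M[int]_(m, n)) :
  map_mx intr A = map_mx (real_complex R) (mxR R A).
Proof. by rewrite -map_mx_comp; apply/matrixP => i j; rewrite !mxE /= rmorph_int. Qed.

(** The norm is at most the sum of the absolute values of all entries, and each entry is summable by
    the complex statement. *)
Lemma summable_inv_exp_norm (R : realType) n (A : 'M[int]_n.+1) :
  H1_expanding R A -> abs_summable (fun k => `|(mxR R A)^-1 ^+ k|).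
Proof.
move=> hA.
have /choice[K hK] (ij : 'I_n.+1 * 'I_n.+1) : exists K : R, forall N,
    \sum_(k < N) `|((mxR R A)^-1 ^+ k) ij.1 ij.2| <= K.
  case: ij => i j /=.
  have [K hK] := @summable_inv_exp _ _ _ hA i j.
  exists (complex.Re K) => N; move: (hK N).
  (* The sum is the image of a real number, so the inequality in [R[i]] can be read on real
     parts. *)
  rewrite (_ : \sum_(k < N) _ = (\sum_(k < N) `|((mxR R A)^-1 ^+ k) i j|)%:C%C).
    by rewrite lecE /= => /andP[].
  rewrite rmorph_sum; apply: eq_bigr => k _ /=.
  rewrite map_mxR_complex.
  by rewrite -map_mx_inv -rmorphXn mxE normc_def /= expr0n addr0 sqrtr_sqr.
exists (\sum_ij K ij) => N.
apply: (@le_trans _ _ (\sum_(k < N) \sum_ij `|((mxR R A)^-1 ^+ k) ij.1 ij.2|)).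
  apply: ler_sum => k _; rewrite normr_id; apply: mx_norm_le => [|i j].
    by apply: sumr_ge0.
  by rewrite (bigD1 (i, j)) //= lerDl sumr_ge0.
by rewrite exchange_big; apply: ler_sum => ij _; apply: hK.
Qed.

Lemma abs_summable_cvg (R : realType) (u : nat -> R) :
  abs_summable u -> cvgn (series (fun k => `|u k|)).
Proof.
move=> [K hK]; apply: nondecreasing_is_cvgn.
  by apply: nondecreasing_series => k _ _ /=.
by exists K => _ [N _ <-]; rewrite /= /series/= big_mkord.
Qed.

Lemma abs_summable_cvg_mx (R : realType) m n (u : nat -> 'M[R]_(m, n)) :
  abs_summable (fun k => `|u k|) -> cvgn (series u).
Proof.
move=> /abs_summable_cvg; under eq_fun do rewrite normr_id.
move=> /cauchy_cvgP/cauchy_seriesP u_ncvg.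
apply/cauchy_cvgP/cauchy_seriesP => e /u_ncvg.
apply: filterS => k /=; rewrite ger0_norm ?sumr_ge0//.
by apply: le_lt_trans; apply: ler_norm_sum.
Qed.

Section Displacement.
Variables (R : realType) (n : nat) (A : 'M[int]_n.+1) (hA : H1_expanding R A).
Variables (T : Type) (iota : T -> 'cV[R]_n.+1) (tf : T -> T)
  (fl : T -> 'cV[int]_n.+1) (C : R).
Hypothesis iota_tf : forall x, `|iota (tf x) - mxR R A *m iota x| <= C.
Hypothesis iota_fl : forall x, `|iota x - mxR R (fl x)| <= C.

Let B := mxR R A.

Lemma mxR_unit : B \is a GRing.unit.
Proof.
have : (map_mx intr A : 'M[R[i]]_n.+1) \in unitmx.
  by apply: expanding_unitmx; apply/negP => /hA; rewrite normr0 ltr10.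
rewrite map_mxR_complex.
by rewrite map_unitmx.
Qed.

Lemma inv_exp_cvg0 : (fun k => `|B^-1 ^+ k|) @ \oo --> (0 : R).
Proof.
apply: cvg_series_cvg_0; have := abs_summable_cvg (summable_inv_exp_norm hA).
by under eq_fun do rewrite normr_id.
Qed.

Lemma tbeta_cvg x :
  (fun k => invmx B ^+ k *m iota (iter k tf x)) @ \oo --> tbeta A iota tf x.
Proof.
set a := (X in X @ _ --> _).
(* [tbeta] is by definition [limn a], so convergence is all there is to prove. *)
suff : cvgn a by [].
have aE k : a k.+1 - a k = B^-1 ^+ k.+1 *m (iota (tf (iter k tf x)) - B *m iota (iter k tf x)).
  rewrite mulmxBr mulmxA; congr (_ - _ *m _).
  by rewrite mulmxE exprSr -mulrA mulVr ?mulr1// mxR_unit.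
have : cvgn (series (fun k => a k.+1 - a k)).
  apply: abs_summable_cvg_mx; have [K hK] := summable_inv_exp_norm hA.
  exists (n.+1%:R * K * C) => N.
  have C0 : 0 <= C by apply: le_trans (iota_tf x).
  apply: (@le_trans _ _ (n.+1%:R * (\sum_(k < N) `|B^-1 ^+ k.+1|) * C)).
    rewrite mulr_sumr mulr_suml; apply: ler_sum => k _; rewrite normr_id aE.
    apply: le_trans (mx_norm_mul _ _) _.
    by rewrite ler_wpM2l// mulr_ge0.
  rewrite ler_wpM2r// ler_wpM2l//; apply: le_trans (hK N.+1).
  rewrite big_ord_recl normr_id; apply: ler_wpDl => //.
  by under [leRHS]eq_bigr do rewrite normr_id.
rewrite (_ : series _ = (fun N => a N - a 0%N)); last first.
  by apply/funext => N; rewrite /series/= telescope_sumr.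
move=> ca; rewrite (_ : a = (fun N => a N - a 0%N) \+ cst (a 0%N)).
  by apply: is_cvgD => //; exact: is_cvg_cst.
by apply/funext => k /=; rewrite subrK.
Qed.

Lemma displacement_limit x :
  (fun k => invmx (B ^+ k - 1%:M) *m mxR R (displacement fl tf k x)) @ \oo
     --> tbeta A iota tf x.
Proof.
pose d k := mxR R (displacement fl tf k x).
pose z k := B^-1 ^+ k *m d k.
pose w k := invmx (B ^+ k - 1%:M) *m d k.
have zcvg : z @ \oo --> tbeta A iota tf x.
  rewrite (_ : z = (fun k => invmx B ^+ k *m iota (iter k tf x))
     \+ (fun k => B^-1 ^+ k *m (d k - iota (iter k tf x)))); last first.
    by apply/funext => k /=; rewrite mulmxBr -[invmx B]/(B^-1) [RHS]addrC subrK.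
  rewrite -[X in _ --> X]addr0; apply: cvgD; first exact: tbeta_cvg.
  apply: norm_cvg0.
  (* [d k] differs from the integer part of the k-th iterate by the fixed vector [fl x]. *)
  pose C' := C + `|mxR R (fl x)|.
  have dk k : `|d k - iota (iter k tf x)| <= C'.
    rewrite (_ : _ - _ = - ((iota (iter k tf x) - mxR R (fl (iter k tf x))) + mxR R (fl x))).
      by rewrite normrN (le_trans (ler_normD _ _))// lerD2r.
    rewrite /d /displacement /mxR map_mxB /=.
    by rewrite opprD opprB addrAC.
  apply: (@squeeze_cvgr _ _ _ _ (fun=> 0) (fun k => n.+1%:R * `|B^-1 ^+ k| * C')).
  - near=> k; rewrite normr_ge0 /=; apply: le_trans (mx_norm_mul _ _) _.
    by rewrite ler_wpM2l// mulr_ge0.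
  - exact: cvg_cst.
  - rewrite [X in _ --> X](_ : 0 = n.+1%:R * 0 * C'); last by rewrite mulr0 mul0r.
    by apply: cvgM; [apply: cvgM; [exact: cvg_cst|exact: inv_exp_cvg0]|exact: cvg_cst].
(* The identity w - z = A^-k w reduces the claim to a bound on w: eventually |w| <= 2 |z|, and z
   converges. *)
suff wz : (fun k => w k - z k) @ \oo --> (0 : 'cV[R]_n.+1).
  rewrite -[X in X @ _]/w (_ : w = z \+ (fun k => w k - z k)); last first.
    by apply/funext => k /=; rewrite [RHS]addrC subrK.
  by rewrite -[X in _ --> X]addr0; apply: cvgD.
apply: norm_cvg0.
have En0 : (fun k => n.+1%:R * `|B^-1 ^+ k|) @ \oo --> (0 : R).
  rewrite [X in _ --> X](_ : 0 = n.+1%:R * 0); last by rewrite mulr0.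
  by apply: cvgM; [exact: cvg_cst|exact: inv_exp_cvg0].
apply: (@squeeze_cvgr _ _ _ _ (fun=> 0)
  (fun k => n.+1%:R * `|B^-1 ^+ k| * (2 * `|z k|))).
- near=> k; rewrite normr_ge0 /=.
  (* This bound serves twice: it excludes a nonzero vector fixed by A^-k, so that A^k - I is
     invertible, and it gives |w - z| <= |w| / 2. It is only an eventual bound; at k = 0 the matrix
     A^k - I vanishes. *)
  have E2 : n.+1%:R * `|B^-1 ^+ k| < 2^-1.
    by near: k; apply: (cvgr_lt _ En0); rewrite invr_gt0.
  have Bk : B ^+ k \is a GRing.unit by rewrite unitrX// mxR_unit.
  have IE : 1 - B^-1 ^+ k \in unitmx.
    apply: expanding_unitmx; apply/negP => /eigenvalueP[v].
    rewrite scale0r mulmxBr mulmx1 => /eqP; rewrite subr_eq0 => /eqP vE.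
    apply/negP; rewrite negbK -normr_le0.
    have := mx_norm_mul v (B^-1 ^+ k); rewrite -vE mulrAC => vle.
    have : `|v| <= 2^-1 * `|v|.
      by apply: le_trans vle _; rewrite ler_wpM2r// ltW.
    by move: `|v| => t; lra.
  have BkE : B ^+ k - 1%:M = B ^+ k *m (1 - B^-1 ^+ k).
    by rewrite mulmxE mulrBr mulr1 exprVn mulrV.
  have Bk1 : B ^+ k - 1%:M \in unitmx.
    by rewrite BkE unitmx_mul IE andbT.
  have wE : w k - z k = B^-1 ^+ k *m w k.
    rewrite /z -[d k](mulKVmx Bk1) -/(w k) mulmxA mulmxBr mulmx1.
    rewrite [_ *m B ^+ k](_ : _ = 1%:M); last by rewrite mulmxE exprVn mulVr.
    by rewrite mulmxBl mul1mx opprB addrC subrK.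
  have wle := mx_norm_mul (B^-1 ^+ k) (w k); rewrite -wE in wle.
  apply: le_trans wle _; rewrite ler_wpM2l// ?mulr_ge0//.
  have w2 : `|w k - z k| <= 2^-1 * `|w k|.
    by rewrite wE; apply: le_trans (mx_norm_mul _ _) _; rewrite ler_wpM2r// ltW.
  have := ler_normD (w k - z k) (z k); rewrite subrK.
  by move: w2; move: `|w k - z k| `|w k| `|z k| => t1 t2 t3; lra.
- exact: cvg_cst.
- rewrite [X in _ --> X](_ : 0 = 0 * (2 * `|tbeta A iota tf x|)); last by rewrite mul0r.
  apply: cvgM; first exact: En0.
  by apply: cvgM; [exact: cvg_cst|exact: cvg_norm].
Unshelve. all: by end_near. Qed.
End Displacement.

(** * Singular chains *)

Section Chains.
Variables (R : realType) (M : topologicalType).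

Lemma coef_cat n (c c' : chain R n M) tau : coef (c ++ c') tau = coef c tau + coef c' tau.
Proof. by rewrite /coef big_cat. Qed.

Lemma coef_scale n k (c : chain R n M) tau : coef (scale_chain k c) tau = k * coef c tau.
Proof. by rewrite /coef /scale_chain big_map mulr_sumr. Qed.

Lemma coef_lin_comb n b (k : 'cV[int]_b) (Gamma : 'I_b -> chain R n M) tau :
  coef (lin_comb k Gamma) tau = \sum_i k i 0 * coef (Gamma i) tau.
Proof.
rewrite /lin_comb /coef big_flatten big_map big_enum.
by apply: eq_bigr => i _; exact: coef_scale.
Qed.

Lemma coef_boundary n (c : chain R n.+1 M) tau :
  coef (boundary c) tau = \sum_(p <- c) \sum_(i < n.+2)
    (if `[< forall v, std_simplex v -> (p.2 \o @face R n i) v = tau v >]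
     then (-1) ^+ i * p.1 else 0).
Proof.
rewrite /coef /boundary big_mkcond big_allpairs_dep /=.
by apply: eq_bigr => q _; rewrite big_enum.
Qed.

Lemma coef_boundary_cat n (c c' : chain R n.+1 M) tau :
  coef (boundary (c ++ c')) tau = coef (boundary c) tau + coef (boundary c') tau.
Proof. by rewrite !coef_boundary big_cat. Qed.

Lemma coef_boundary_scale n k (c : chain R n.+1 M) tau :
  coef (boundary (scale_chain k c)) tau = k * coef (boundary c) tau.
Proof.
rewrite !coef_boundary big_map mulr_sumr; apply: eq_bigr => q _ /=.
rewrite mulr_sumr; apply: eq_bigr => i _.
by case: ifP => _; rewrite ?mulr0// mulrCA.
Qed.

Lemma is_chain_cat n (c c' : chain R n M) : is_chain c -> is_chain c' -> is_chain (c ++ c').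
Proof. by move=> hc hc' s; rewrite mem_cat => /orP[/hc|/hc']. Qed.

Lemma is_chain_scale n k (c : chain R n M) : is_chain c -> is_chain (scale_chain k c).
Proof. by move=> hc s /mapP[t tc ->]; exact: (hc t). Qed.

Lemma homologousP n (c c' : chain R n M) : homologous c c' <->
  exists2 d : chain R n.+1 M, is_chain d &
    forall tau, coef c tau = coef c' tau + coef (boundary d) tau.
Proof.
by split=> -[d hd h]; exists d => // tau; [rewrite h coef_cat|rewrite coef_cat h].
Qed.

Lemma homologous_coef n (c c' : chain R n M) :
  (forall tau, coef c tau = coef c' tau) -> homologous c c'.
Proof. by move=> h; exists [::] => // tau; rewrite cats0 h. Qed.

Lemma homologous_trans n (c1 c2 c3 : chain R n M) :
  homologous c1 c2 -> homologous c2 c3 -> homologous c1 c3.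
Proof.
move=> /homologousP[d hd h] /homologousP[d' hd' h']; apply/homologousP.
exists (d' ++ d); first exact: is_chain_cat.
by move=> tau; rewrite coef_boundary_cat addrA -h'.
Qed.

Lemma homologous_lin_comb n b (k : 'cV[int]_b) (Gamma Gamma' : 'I_b -> chain R n M) :
  (forall i, homologous (Gamma i) (Gamma' i)) ->
  homologous (lin_comb k Gamma) (lin_comb k Gamma').
Proof.
move=> h; have /choice[d hd] i : exists d, is_chain d /\ forall tau,
    coef (Gamma i) tau = coef (Gamma' i) tau + coef (boundary d) tau.
  by have /homologousP[d hd1 hd2] := h i; exists d.
apply/homologousP; exists (lin_comb k d).
  move=> s /flattenP[e /mapP[i _ ->]]; apply: is_chain_scale; exact: (hd i).1.
move=> tau; rewrite !coef_lin_comb.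
rewrite (_ : coef _ _ = \sum_i k i 0 * coef (boundary (d i)) tau).
  by rewrite -big_split /=; apply: eq_bigr => i _; rewrite (hd i).2 mulrDr.
rewrite coef_boundary /lin_comb big_flatten big_map big_enum.
by apply: eq_bigr => i _; rewrite -coef_boundary coef_boundary_scale.
Qed.

Lemma lin_comb_mul n b (A : 'M[int]_b) (k : 'cV[int]_b) (Gamma : 'I_b -> chain R n M) :
  homologous (lin_comb k (fun j => lin_comb (col j A) Gamma)) (lin_comb (A *m k) Gamma).
Proof.
apply: homologous_coef => tau; rewrite !coef_lin_comb.
under eq_bigr do rewrite coef_lin_comb mulr_sumr.
rewrite exchange_big; apply: eq_bigr => i _ /=; rewrite mxE mulr_suml.
by apply: eq_bigr => j _; rewrite !mxE mulrA (mulrC (k j 0)).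
Qed.

Lemma lin_comb_delta n b (Gamma : 'I_b -> chain R n M) j :
  homologous (lin_comb (delta_mx j 0) Gamma) (Gamma j).
Proof.
apply: homologous_coef => tau; rewrite coef_lin_comb (bigD1 j)//= mxE !eqxx mul1r.
by rewrite big1 ?addr0// => i ij; rewrite mxE (negPf ij) mul0r.
Qed.

(** Face 0 is the endpoint [gamma 1] and face 1 the origin [gamma 0]. On a loop they are the same
    0-simplex, and their opposite signs cancel. *)
Lemma path_chain_cycle (gamma : R -> M) :
  continuous gamma -> gamma 0 = gamma 1 -> is_cycle (path_chain gamma).
Proof.
move=> cg g01; split=> [s|tau].
  rewrite inE => /eqP -> /=; apply: continuous_subspaceT => v.
  by apply: continuous_comp; [exact: coord_continuous|exact: cg].
rewrite coef_boundary big_seq1 /coef big_nil /= !big_ord_recl big_ord0 addr0 /=.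
set P := `[< _ >]; set Q := `[< _ >].
rewrite expr0 expr1 mul1r mulr1.
suff -> : P = Q by case: Q.
have sx (v : 'rV[R]_1) : std_simplex v -> v 0 0 = 1.
  by move=> [_]; rewrite big_ord_recl big_ord0 addr0.
have face0 (v : 'rV[R]_1) : std_simplex v -> @face R 0 ord0 v 0 ord_max = 1.
  move=> /sx v1; rewrite mxE.
  have -> : ord_max = lift (@ord0 1) ord0 by apply/val_inj.
  by rewrite liftK.
have face1 (v : 'rV[R]_1) : @face R 0 (lift ord0 ord0) v 0 ord_max = 0.
  rewrite mxE.
  have -> : lift ord0 ord0 = @ord_max 1 by apply/val_inj.
  by rewrite unlift_none.
apply: asbool_equiv_eq; split=> h v hv; rewrite -h//=.
  by rewrite face0// face1.
by rewrite face0// face1.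
Qed.
End Chains.

Section Push.
Variables (R : realType) (M N : topologicalType) (f : M -> N).

(* A chain is only a list of weighted simplices, so a functional of chains is well defined once its
   value on a simplex depends only on the restriction of the simplex to [std_simplex]. *)
Lemma coef_eq0_sum n (F : ('rV[R]_n.+1 -> M) -> int) (c : chain R n M) :
  (forall s t, (forall v, std_simplex v -> s v = t v) -> F s = F t) ->
  (forall tau, coef c tau = 0) -> \sum_(p <- c) p.1 * F p.2 = 0.
Proof.
move=> hF; have [m] := ubnP (size c); elim: m c => // m IH [|q c] hm hc.
  by rewrite big_nil.
pose e (s t : 'rV[R]_n.+1 -> M) := `[< forall v, std_simplex v -> s v = t v >].
(* The simplices that agree with the head contribute its coefficient times one value of F, hence 0.
   The others form a shorter list whose coefficients still vanish. *)
rewrite (bigID (fun p => e p.2 q.2)) /= -[X in _ + X]big_filter.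
rewrite [X in _ + X]IH ?addr0.
- rewrite (eq_bigr (fun p => p.1 * F q.2)).
    by rewrite -mulr_suml -/(coef (q :: c) q.2) hc mul0r.
  by move=> p /asboolP h; rewrite (hF _ _ h).
- rewrite /= (_ : e q.2 q.2 = true) /=; last by apply/asboolP.
  by rewrite size_filter; apply: leq_ltn_trans (count_size _ _) _.
- move=> tau; have := hc tau; rewrite /coef big_filter_cond.
  have [/asboolP h|/negP h] := boolP (e tau q.2).
    move=> _; apply: big1 => p /andP[/negP h1 /asboolP h2]; case: h1.
    by apply/asboolP => v hv; rewrite h2// h.
  move=> hq; rewrite -[RHS]hq; apply: eq_bigl => p; case: asboolP => h2; rewrite ?andbF// andbT.
  apply/negP => /asboolP h3; case: h; apply/asboolP => v hv.
  by rewrite -h2// h3.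
Qed.

Lemma chain_eq_push n (c c' : chain R n M) :
  chain_eq c c' -> chain_eq (push_chain f c) (push_chain f c').
Proof.
move=> h tau; apply/eqP; rewrite -subr_eq0; apply/eqP.
(* With this indicator, a coefficient of the pushed chain is an F-weighted sum over the original
   chain; the vanishing lemma then applies to c - c'. *)
pose F (s : 'rV[R]_n.+1 -> M) : int := `[< forall v, std_simplex v -> f (s v) = tau v >]%:R.
have cE (d : chain R n M) : coef (push_chain f d) tau = \sum_(p <- d) p.1 * F p.2.
  rewrite /coef big_map big_mkcond; apply: eq_bigr => p _ /=.
  by rewrite /F; case: asbool; rewrite ?mulr1 ?mulr0.
rewrite !cE -mulN1r -[X in _ + X](_ : \sum_(p <- scale_chain (-1) c') p.1 * F p.2 = _); last first.
  by rewrite big_map mulr_sumr; apply: eq_bigr => p _ /=; rewrite mulrA.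
rewrite -big_cat; apply: coef_eq0_sum => [s t st|sigma].
  rewrite /F; congr ((nat_of_bool _)%:R); apply: asbool_equiv_eq.
  by split=> H v hv; rewrite -(H v hv) st.
by rewrite coef_cat coef_scale mulN1r h subrr.
Qed.

Lemma push_homologous n (c c' : chain R n M) : continuous f ->
  homologous c c' -> homologous (push_chain f c) (push_chain f c').
Proof.
move=> cf [d hd h]; exists (push_chain f d).
  move=> _ /mapP[t td ->]; apply: within_continuous_comp => [z _|]; first exact: cf.
  exact: (hd t td).
move=> tau; rewrite (chain_eq_push h) /push_chain map_cat; congr (coef (_ ++ _) tau).
rewrite /boundary map_allpairs allpairs_mapl //.
Qed.

Lemma push_lin_comb n b (k : 'cV[int]_b) (Gamma : 'I_b -> chain R n M) :
  push_chain f (lin_comb k Gamma) = lin_comb k (fun i => push_chain f (Gamma i)).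
Proof.
rewrite /lin_comb /push_chain map_flatten -map_comp; congr flatten.
by apply: eq_map => i /=; rewrite /scale_chain -!map_comp.
Qed.
End Push.

(** * Smooth functions of a real variable *)

Lemma near_open (T : topologicalType) (D : set T) (P : T -> Prop) x :
  open D -> D x -> (forall y, D y -> P y) -> \forall y \near x, P y.
Proof. by move=> oD Dx DP; apply: filterS DP _; apply: open_nbhs_nbhs. Qed.

Lemma near_eq_continuous_at (T U : topologicalType) (f g : T -> U) x :
  (\near x, f x = g x) -> {for x, continuous f} -> {for x, continuous g}.
Proof.
move=> fg cf; rewrite /prop_for /continuous_at -(nbhs_singleton fg).
exact: cvg_trans (near_eq_cvg fg) cf.
Qed.

Section CkR.
Variables (R : realType) (V : normedModType R).
Implicit Types (f g : R -> V) (D : set R).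

Lemma Ck_ext k D f g : open D -> (forall x, D x -> f x = g x) -> Ck k D f -> Ck k D g.
Proof.
move=> oD; elim: k f g => [|k IH] f g fg /=.
  by move=> cf x Dx; apply: near_eq_continuous_at (cf x Dx); exact: near_open Dx fg.
move=> [df hf]; split=> [x Dx|v].
  by apply/derivable1_diffP; apply: near_eq_derivable (near_open oD Dx fg) _;
    apply/derivable1_diffP; exact: df.
apply: IH (hf v) => x Dx; apply: near_eq_derive; exact: near_open Dx fg.
Qed.

Lemma derive_derive1 f (x v : R) : differentiable f x -> 'D_v f x = v *: f^`()%classic x.
Proof. by move=> df; rewrite deriveE// diff1E. Qed.

Lemma Ck_sub k D E f : D `<=` E -> Ck k E f -> Ck k D f.
Proof.
move=> DE; elim: k f => [|k IH] f /=; first by move=> h x /DE/h.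
by move=> [h1 h2]; split=> [x /DE/h1|v]//; exact: IH (h2 v).
Qed.

Lemma Ck_cont k D f : Ck k D f -> forall x, D x -> {for x, continuous f}.
Proof.
by case: k => // k [h _] x /h; exact: differentiable_continuous.
Qed.

Lemma Ck_scale k D f (a : R) : open D -> Ck k D f -> Ck k D (fun x => a *: f x).
Proof.
move=> oD; elim: k f => [|k IH] f /=.
  by move=> h x /h cf; apply: cvgZ; [exact: cvg_cst|exact: cf].
move=> [h1 h2]; split=> [x /h1|v]; first exact: differentiableZ.
apply: Ck_ext (IH _ (h2 v)) => // x Dx; apply/esym.
by rewrite (deriveZ a)//; apply: diff_derivable; exact: h1.
Qed.

(** On the line every directional derivative is a multiple of the ordinary one, so the quantifier
    over directions in [Ck] collapses to a single derivative. *)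
Lemma CkSP k D f : open D ->
  Ck k.+1 D f <-> (forall x, D x -> derivable f x 1) /\ Ck k D f^`()%classic.
Proof.
move=> oD; split=> -[h1 h2]; split.
- by move=> x /h1 df; apply/derivable1_diffP.
- by apply: Ck_ext (h2 1) => // x Dx; rewrite derive1E.
- by move=> x /h1 df; apply/derivable1_diffP.
- move=> v; apply: Ck_ext (Ck_scale v oD h2) => // x Dx.
  by rewrite derive_derive1//; apply/derivable1_diffP; exact: h1.
Qed.

Lemma Ck_mono k D f : Ck k.+1 D f -> Ck k D f.
Proof.
elim: k f => [|k IH] f.
  by move=> h x; exact: Ck_cont h x.
by case=> h1 h2; split=> // v; exact: IH.
Qed.

Lemma CkD k D f g : open D -> Ck k D f -> Ck k D g -> Ck k D (fun x => f x + g x).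
Proof.
move=> oD; elim: k f g => [|k IH] f g.
  by move=> hf hg x Dx; apply: cvgD; [exact: hf|exact: hg].
move=> [f1 f2] [g1 g2]; split=> [x Dx|v].
  by apply: differentiableD; [exact: f1|exact: g1].
apply: Ck_ext (IH _ _ (f2 v) (g2 v)) => // x Dx; apply/esym.
by rewrite deriveD//; apply: diff_derivable; [exact: f1|exact: g1].
Qed.

Lemma Ck_cst k D (a : V) : open D -> Ck k D (fun=> a).
Proof.
move=> oD; elim: k a => [|k IH] a; first by move=> x _; exact: cvg_cst.
split=> [x _|v]; first exact: differentiable_cst.
by apply: Ck_ext (IH 0) => // x _; rewrite derive_cst.
Qed.

End CkR.

Section CkReal.
Variable R : realType.
Implicit Types (f g : R -> R) (D : set R).

Lemma CkM k D f g : open D -> Ck k D f -> Ck k D g -> Ck k D (fun x => f x * g x).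
Proof.
move=> oD; elim: k f g => [|k IH] f g.
  by move=> hf hg x Dx; apply: cvgM; [exact: hf|exact: hg].
move=> hf hg; have /CkSP[//|f1 f2] := hf; have /CkSP[//|g1 g2] := hg.
apply/CkSP => //; split=> [x Dx|].
  by apply: derivableM; [exact: f1|exact: g1].
have := CkD oD (IH _ _ (Ck_mono hf) g2) (IH _ _ (Ck_mono hg) f2).
apply: Ck_ext => // x Dx; rewrite [RHS]derive1E.
by rewrite (deriveM (f1 _ Dx) (g1 _ Dx)) -!derive1E.
Qed.

Lemma Ck_comp k D E f g : open D -> open E -> (forall x, D x -> E (f x)) ->
  Ck k D f -> Ck k E g -> Ck k D (g \o f).
Proof.
move=> oD oE DE; elim: k f g DE => [|k IH] f g DE.
  by move=> hf hg x Dx; apply: continuous_comp; [exact: hf|apply: hg; exact: DE].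
move=> hf hg; have /CkSP[//|f1 f2] := hf; have /CkSP[//|g1 g2] := hg.
apply/CkSP => //; split=> [x Dx|].
  apply/derivable1_diffP; apply: differentiable_comp; apply/derivable1_diffP.
    exact: f1.
  by apply: g1; exact: DE.
have := CkM oD (IH _ _ DE (Ck_mono hf) g2) f2; apply: Ck_ext => // x Dx.
rewrite [RHS]derive1_comp//; first exact: f1.
by apply: g1; exact: DE.
Qed.

Lemma Ck_id k D : open D -> Ck k D (fun x : R => x).
Proof.
move=> oD; case: k => [|k]; first by move=> x _; exact: cvg_id.
apply/CkSP => //; split=> [x _|]; first exact: derivable_id.
apply: (Ck_ext oD _ (Ck_cst k (1 : R) oD)) => x _.
by rewrite derive1E derive_id.
Qed.

Lemma Ck_affine k D (a c : R) : open D -> Ck k D (fun x => a * x + c).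
Proof.
by move=> oD; apply: CkD => //; [apply: CkM => //; [exact: Ck_cst|exact: Ck_id]|exact: Ck_cst].
Qed.

(** Curves read in charts are row-valued, while the product and composition rules above are for real
    functions; coordinates carry them over. *)
Lemma Ck_rowP k D m (f : R -> 'rV[R]_m) : open D ->
  Ck k D f <-> forall j, Ck k D (fun x => f x 0 j).
Proof.
move=> oD; elim: k f => [|k IH] f.
  split=> h.
    move=> j x /h cf.
    exact: (continuous_comp cf (@coord_continuous R 1 m 0 j _)).
  move=> x Dx; change (f @ x --> f x); apply/cvgrPdist_lt => e e0.
  have : nbhs (x : R) [set t | forall j, `|f x 0 j - f t 0 j| < e].
    apply: (@filter_forall R _ (fun j t => `|f x 0 j - f t 0 j| < e) (nbhs (x : R))
      (nbhs_filter x)) => j.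
    have hj : (fun t => f t 0 j) @ x --> f x 0 j := h j x Dx.
    exact: (cvgr_dist_lt _ _ hj e e0).
  apply: filterS => t ht; rewrite [ltLHS]/Num.norm /= mx_normrE.
  by apply/bigmax_ltP; split => // -[i j] _ /=; rewrite ord1 !mxE.
split=> [/CkSP[//|h1 h2] j|h].
  apply/CkSP => //; split=> [x /h1/derivable_mxP/(_ 0 j)//|].
  have /IH/(_ j) := h2; apply: Ck_ext => // x Dx.
  by rewrite derive1E derive_mx ?mxE ?derive1E//; exact: h1.
have hd x : D x -> derivable f x 1.
  move=> Dx; apply/derivable_mxP => i j; rewrite ord1.
  by have /CkSP[//|+ _] := h j; exact.
apply/CkSP => //; split => //; apply/IH => j.
have /CkSP[//|_ h2] := h j; apply: Ck_ext h2 => // x Dx.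
by rewrite !derive1E derive_mx ?mxE//; exact: hd.
Qed.

End CkReal.

(** * A smooth step function *)

Section FlatStep.
Variable R : realType.

(** The polynomial factor makes the family P(1/t) exp(-1/t) stable under differentiation, P becoming
    X^2 (P - P'); smoothness is then a plain induction. *)
Definition flat_exp (P : {poly R}) (t : R) : R :=
  if 0 < t then P.[t^-1] * expR (- t^-1) else 0.

(** From y^(i+1) / (i+1)! <= exp y at y = 1/t, each term t^-i exp(-1/t) is at most (i+1)! t; the
    extra degree provides the factor t. *)
Lemma flat_exp_bound (P : {poly R}) :
  exists2 K, 0 <= K & forall t, `|flat_exp P t| <= K * `|t|.
Proof.
exists (\sum_(i < size P) `|P`_i| * i.+1`!%:R).
  by apply: sumr_ge0 => i _; rewrite mulr_ge0.
move=> t; rewrite /flat_exp; case: ifPn => t0; last first.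
  by rewrite normr0 mulr_ge0//; apply: sumr_ge0 => i _; rewrite mulr_ge0.
rewrite horner_coef mulr_suml mulr_suml; apply: le_trans (ler_norm_sum _ _ _) _.
apply: ler_sum => i _; rewrite -!mulrA normrM ler_wpM2l// (gtr0_norm t0).
rewrite ger0_norm; last by rewrite mulr_ge0 ?expR_ge0// exprn_ge0// invr_ge0 ltW.
rewrite expRN ler_pdivrMr ?expR_gt0// -mulrA.
have y0 : 0 < t^-1 by rewrite invr_gt0.
have := expR_ge1Dxn i (ltW y0); set E := expR _ => hE.
have {}hE : (t^-1) ^+ i.+1 <= E * i.+1`!%:R.
  rewrite -ler_pdivrMr ?ltr0n ?fact_gt0//; apply: le_trans hE.
  by rewrite lerDr.
rewrite -(ler_pM2l y0) -exprS (le_trans hE)// mulrCA [X in _ <= _ * X]mulrA.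
by rewrite mulVf ?gt_eqF// mul1r mulrC.
Qed.

Lemma is_derive_flat_exp (P : {poly R}) (t : R) :
  is_derive t 1 (flat_exp P) (flat_exp ('X^2 * (P - P^`())) t).
Proof.
have [t0|t0|<-] := ltgtP 0 t.
- have tn0 : t != 0 by rewrite gt_eqF.
  have fg s : [set s | 0 < s] s -> P.[s^-1] * expR (- s^-1) = flat_exp P s.
    by rewrite /flat_exp /= => ->.
  apply: (@near_eq_is_derive _ _ _ _ _ _ _ _ (near_open (@open_gt _ 0) t0 fg)).
  have dV : is_derive t 1 (fun s : R => s^-1) (- t ^- 2).
    apply: is_derive_eq; first exact: (is_deriveV tn0 (is_derive_id _ _)).
    by rewrite /= [LHS]mulr1.
  have dP : is_derive t 1 (fun s : R => P.[s^-1]) (P^`().[t^-1] * - t ^- 2).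
    exact: (@is_derive1_comp _ (horner P) (fun s => s^-1)).
  have dE : is_derive t 1 (fun s : R => expR (- s^-1)) (expR (- t^-1) * t ^- 2).
    apply: (@is_derive1_comp _ expR (fun s => - s^-1)).
    by apply: is_derive_eq; rewrite opprK.
  rewrite (_ : flat_exp _ _ = P.[t^-1] *: (expR (- t^-1) * t ^- 2)
    + expR (- t^-1) *: (P^`().[t^-1] * - t ^- 2)); first exact: (is_deriveM dP dE).
  rewrite /flat_exp t0 /= !hornerE.
  rewrite -!(mulrC (t ^- 2)) /GRing.scale /=.
  rewrite exprVn; move: (P.[t^-1]) (P^`().[t^-1]) (expR _) (t ^- 2) => a c d e.
  by ring.
- rewrite {2}/flat_exp (lt_gtF t0).
  have fg s : [set s | s < 0] s -> cst 0 s = flat_exp P s.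
    by rewrite /flat_exp /= => s0; rewrite (lt_gtF s0).
  apply: (@near_eq_is_derive _ _ _ (cst 0) _ _ _ _ (near_open (@open_lt _ 0) t0 fg)).
- rewrite {2}/flat_exp ltxx.
  (* The difference quotient at 0 of the function for P is the function for X P, which the bound
     sends to 0. *)
  have [K K0 hK] := flat_exp_bound ('X * P).
  have cv : h^-1 *: ((flat_exp P \o shift 0) (h *: (1 : R)) - flat_exp P 0) @[h --> 0^']
      --> (0 : R).
    apply: norm_cvg0.
    apply: (@squeeze_cvgr _ _ _ _ (fun=> 0) (fun h => K * `|h|)).
    + near=> h; rewrite normr_ge0 /=; apply: le_trans (hK h).
      rewrite {2}/flat_exp ltxx subr0 addr0 [h *: 1]mulr1 /flat_exp.
      case: ifP => h0; last by rewrite scaler0.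
      by rewrite hornerM hornerX -mulrA lexx.
    + exact: cvg_cst.
    + rewrite [X in _ --> X](_ : 0 = K * `|0 : R|); last by rewrite normr0 mulr0.
      apply: cvgM; first exact: cvg_cst.
      apply: cvg_norm; exact: nbhs_dnbhs.
  apply: DeriveDef; first by apply/cvg_ex; exists 0.
  exact: cvg_lim cv.
Unshelve. all: by end_near. Qed.

Lemma Ck_flat_exp k (P : {poly R}) : Ck k setT (flat_exp P).
Proof.
elim: k P => [|k IH] P.
  move=> x _; apply: differentiable_continuous; apply/derivable1_diffP.
  by have [] := is_derive_flat_exp P x.
apply/CkSP; first exact: openT.
split=> [x _|]; first by have [] := is_derive_flat_exp P x.
apply: Ck_ext (IH ('X^2 * (P - P^`()))); first exact: openT.
by move=> x _; rewrite derive1E; have [_ ->] := is_derive_flat_exp P x.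
Qed.

Let e := flat_exp 1.

Let e_le0 t : t <= 0 -> e t = 0.
Proof. by rewrite /e /flat_exp leNgt => /negbTE ->. Qed.

Let e_gt0 t : 0 < t -> 0 < e t.
Proof. by move=> t0; rewrite /e /flat_exp t0 hornerE mul1r expR_gt0. Qed.

Let e_ge0 t : 0 <= e t.
Proof. by have [/e_le0 ->|/e_gt0/ltW] := leP t 0. Qed.

Let e_homo s t : s <= t -> e s <= e t.
Proof.
move=> st; have [/e_le0 ->|s0] := leP s 0; first exact: e_ge0.
have t0 : 0 < t by exact: lt_le_trans st.
by rewrite /e /flat_exp s0 t0 !hornerE ler_expR lerN2 lef_pV2.
Qed.

(* With [e t = exp(-1/t)] for [t > 0] and [0] otherwise, [t |-> e (e 1 - e (1 - t)) / e (e 1)]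
   is a smooth step from 0 on [t <= 0] to 1 on [t >= 1], rescaled here to [1/4, 3/4]. *)
Lemma smooth_step_exists : exists s : R -> R,
  [/\ forall k, Ck k setT s, forall t, t <= 1 / 4 -> s t = 0,
      forall t, 3 / 4 <= t -> s t = 1 & forall t, 0 <= s t <= 1].
Proof.
have oT : open (@setT R) by exact: openT.
have c0 : 0 < e (e 1) by rewrite !e_gt0.
exists (fun t => (e (e 1))^-1 * e (e 1 - e (3 / 2 - 2 * t))); split.
- move=> k; apply: CkM => //; first exact: Ck_cst.
  apply: (@Ck_comp _ k setT setT (fun t => e 1 - e (3 / 2 - 2 * t)) e) => //;
    last exact: Ck_flat_exp.
  apply: (@Ck_comp _ k setT setT (fun t => 3 / 2 - 2 * t) (fun t => e 1 - e t)) => //.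
    by apply: Ck_ext (Ck_affine k (- 2) (3 / 2) oT) => // x _; ring.
  apply: Ck_ext (CkD oT (Ck_cst k (e 1) oT) (Ck_scale (-1) oT (Ck_flat_exp k 1))) => // x _.
  by rewrite scaleN1r.
- move=> t t4; rewrite (@e_le0 (_ - _)) ?mulr0// subr_le0; apply: e_homo; lra.
- move=> t t4; rewrite (@e_le0 (_ - 2 * t)) ?subr0 ?mulVf ?gt_eqF//; lra.
- move=> t; rewrite mulr_ge0 ?e_ge0 ?invr_ge0//= ler_pdivrMl// mulr1.
  by apply: e_homo; rewrite gerDl oppr_le0.
Qed.

End FlatStep.

(** * Smooth curves and path integrals *)

(** The interval exceeds [0, 1] on both sides so that the primitive has two-sided derivatives at 0
    and 1. *)
Lemma primitive_exists (R : realType) (F : R -> R) : continuous F ->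
  exists G : R -> R, forall x : R, -1 < x < 2 -> is_derive x 1 G (F x).
Proof.
move=> cF; exists (fun x => \int[@lebesgue_measure R]_(t in `[-1, x]) F t)%R => x /andP[x1 x2].
have iF : (@lebesgue_measure R).-integrable `[-1, 2] (EFin \o F).
  apply: continuous_compact_integrable; first exact: segment_compact.
  exact: continuous_subspaceT.
have [d1 d2] := continuous_FTC1_closed x2 iF x1 (cF x).
by apply: DeriveDef => //; rewrite -derive1E.
Qed.

Lemma Rintegral_primitive (R : realType) (F H : R -> R) : continuous F ->
  (forall x : R, 0 <= x <= 1 -> is_derive x 1 H (F x)) ->
  \int[@lebesgue_measure R]_(t in `[0, 1]) F t = H 1 - H 0.
Proof.
move=> cF dH; rewrite /Rintegral (@continuous_FTC2 _ _ H) ?ltr01//.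
- exact: continuous_subspaceT.
- have cH (x : R) : 0 <= x <= 1 -> {for x, continuous H}.
    move=> /dH[h _]; apply: differentiable_continuous; exact/derivable1_diffP.
  split.
  + by move=> x; rewrite in_itv /= => /andP[x0 x1]; have := dH x; rewrite !ltW// => /(_ isT)[].
  + by apply: cvg_at_right_filter; apply: cH; rewrite lexx ler01.
  + by apply: cvg_at_left_filter; apply: cH; rewrite lexx ler01.
- move=> x; rewrite in_itv /= => /andP[x0 x1].
  by rewrite derive1E; have := dH x; rewrite !ltW// => /(_ isT)[_ ->].
Qed.

Section Curves.
Variables (R : realType) (m : nat) (M : topologicalType) (S : smooth_atlas R m M).
Implicit Types (c : R -> M) (w : one_form R m M).

(** The local condition of [smooth_path]. Asking it at every real time, as [smooth_curve] does,
    spares any special treatment of the ends of [0, 1] under reparametrization. *)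
Definition smooth_at c (t : R) := exists (phi : chart R m M) (J : set R),
  [/\ charts S phi, open J, J t, c @` J `<=` dom phi & smooth_on J (cmap phi \o c)].

Definition smooth_curve c := forall t, smooth_at c t.

Lemma smooth_curve_path c : smooth_curve c -> smooth_path S c.
Proof. by move=> h t _; exact: h. Qed.

Lemma smooth_at_near c c' t : (\near t, c t = c' t) -> smooth_at c t -> smooth_at c' t.
Proof.
move=> h; have : nbhs t [set s | c s = c' s] := h.
rewrite nbhsE => -[K [oK Kt] Kc] [phi [J [hphi oJ Jt Jphi sJ]]].
exists phi, (J `&` K); split => //; first exact: openI.
  by move=> _ [s [Js Ks] <-]; rewrite -(Kc s Ks); apply: Jphi; exists s.
move=> k; apply: Ck_ext (Ck_sub (@subIsetl _ J K) (sJ k)); first exact: openI.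
by move=> s [_ Ks]; rewrite /= (Kc s Ks).
Qed.

Lemma smooth_at_continuous c t : smooth_at c t -> {for t, continuous c}.
Proof.
move=> [phi [J [hphi oJ Jt Jphi sJ]]].
have Jd s : J s -> dom phi (c s) by move=> Js; apply: Jphi; exists s.
have fg s : J s -> (cinv phi \o (cmap phi \o c)) s = c s.
  by move=> Js; rewrite /= cmapK//; exact: Jd.
apply: near_eq_continuous_at (near_open oJ Jt fg) _.
apply: continuous_comp; first exact: (sJ 0%N t Jt).
by apply: cinv_continuous; exists (c t) => //; exact: Jd.
Qed.

Lemma smooth_at_comp c (s : R -> R) t : smooth_on setT s ->
  smooth_at c (s t) -> smooth_at (c \o s) t.
Proof.
move=> ss [phi [J [hphi oJ Jt Jphi sJ]]].
have cs : continuous s by move=> x; exact: (ss 0%N x I).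
have oK : open (s @^-1` J) by apply: open_comp => // x _; exact: cs.
exists phi, (s @^-1` J); split => //.
  by move=> _ [x Jx <-]; apply: Jphi; exists (s x).
move=> k; apply/Ck_rowP => // j.
apply: (@Ck_comp _ k (s @^-1` J) J s (fun x => (cmap phi \o c) x 0 j)) => //.
- exact: Ck_sub (@subsetT _ _) (ss k).
- by have /Ck_rowP := sJ k; exact.
Qed.

Definition integrand w c (t : R) : R :=
  let phi := chart_at S (c t) in
  (derive1 (cmap phi \o c) t *m w phi (cmap phi (c t))) 0 0.

Lemma path_integralE w c :
  path_integral S w c = \int[@lebesgue_measure R]_(t in `[0, 1]) integrand w c t.
Proof. by []. Qed.

(** The integrand uses [chart_at] at the moving point, which may jump with t. The chain rule and the
    transformation law of covectors cancel, so a chart fixed near t gives the same value. *)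
Lemma integrand_chart w c t phi (J : set R) : is_one_form S w ->
  charts S phi -> open J -> J t -> c @` J `<=` dom phi -> smooth_on J (cmap phi \o c) ->
  integrand w c t = (derive1 (cmap phi \o c) t *m w phi (cmap phi (c t))) 0 0.
Proof.
move=> [_ hw] hphi oJ Jt Jphi sJ; rewrite /integrand.
set psi := chart_at S (c t); set g := cmap phi \o c.
have Jd s : J s -> dom phi (c s) by move=> Js; apply: Jphi; exists s.
have hpsi : charts S psi by exact: chart_at_charts.
have ou : overlap phi psi (g t).
  by exists (c t) => //; split; [exact: Jd|exact: dom_chart_at].
have dtr : differentiable (transition phi psi) (g t).
  have [h _] := smooth_transition hphi hpsi 1; exact: h.
have dg : differentiable g t by have [h _] := sJ 1%N; exact: h.
have fg s : J s -> (transition phi psi \o g) s = (cmap psi \o c) s.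
  by move=> Js; rewrite /transition /= cmapK//; exact: Jd.
have -> : derive1 (cmap psi \o c) t = derive1 g t *m jacobian (transition phi psi) (g t).
  rewrite derive1E -(near_eq_derive _ (near_open oJ Jt fg)) -derive1E.
  rewrite derive1E'; last exact: differentiable_comp.
  by rewrite diff_comp//= -deriveE// deriveEjacobian// -derive1E'.
rewrite -mulmxA (hw _ _ _ hphi hpsi ou) /transition /=.
by rewrite cmapK//; exact: Jd.
Qed.

Lemma integrand_continuous w c : is_one_form S w -> smooth_curve c ->
  continuous (integrand w c).
Proof.
move=> hw sc t; have [phi [J [hphi oJ Jt Jphi sJ]]] := sc t.
set g := cmap phi \o c.
have fg s : J s -> \sum_j (derive1 g s) 0 j * (w phi (g s)) j 0 = integrand w c s.
  by move=> Js; rewrite (integrand_chart hw hphi oJ Js Jphi sJ) mxE.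
apply: near_eq_continuous_at (near_open oJ Jt fg) _.
apply: cvg_big => [x|j _]; [exact: add_continuous|apply: cvgM].
  have /CkSP[//|_ cg] := sJ 1%N.
  exact: (continuous_comp (cg t Jt) (@coord_continuous R 1 m 0 j _)).
have cw : {for g t, continuous (w phi)}.
  apply: (hw.1 _ hphi 0%N); exists (c t) => //; apply: Jphi; by exists t.
have cg : {for t, continuous g} := sJ 0%N t Jt.
exact: (continuous_comp (continuous_comp cg cw) (@coord_continuous R m 1 j 0 _)).
Qed.

Lemma smooth_affine (a d : R) : smooth_on setT (fun t : R => a * t + d).
Proof. by move=> k; apply: Ck_affine; exact: openT. Qed.

Lemma derive1_affine (V : normedModType R) (g : R -> V) (a d t : R) :
  differentiable g (a * t + d) ->
  derive1 (g \o (fun t => a * t + d)) t = a *: derive1 g (a * t + d).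
Proof.
move=> dg; have [ds _] := smooth_affine a d 1; have {}ds := ds t I.
rewrite derive1E'; last exact: differentiable_comp.
rewrite diff_comp//= (diff1E dg) diff1E// scale1r; congr (_ *: _).
by rewrite derive1E deriveD// derive_cst addr0 deriveMl// derive_id mulr1.
Qed.

Lemma integrand_affine w c (a d t : R) : is_one_form S w -> smooth_curve c ->
  integrand w (c \o (fun t => a * t + d)) t = a * integrand w c (a * t + d).
Proof.
move=> hw sc; have [phi [J [hphi oJ Jt Jphi sJ]]] := sc (a * t + d).
set s := fun t => a * t + d; set g := cmap phi \o c.
have cs : continuous s by move=> x; exact: (smooth_affine a d 0%N x I).
have oK : open (s @^-1` J) by apply: open_comp => // x _; exact: cs.
have sK : smooth_on (s @^-1` J) (cmap phi \o (c \o s)).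
  move=> k; apply/Ck_rowP => // j.
  apply: (@Ck_comp _ k (s @^-1` J) J s (fun x => g x 0 j)) => //.
  - exact: Ck_sub (@subsetT _ _) (smooth_affine a d k).
  - by have /Ck_rowP := sJ k; exact.
have Kphi : (c \o s) @` (s @^-1` J) `<=` dom phi.
  by move=> _ [x Jx <-]; apply: Jphi; exists (s x).
rewrite (integrand_chart hw hphi oK Jt Kphi sK) (integrand_chart hw hphi oJ Jt Jphi sJ).
rewrite (_ : cmap phi \o (c \o s) = g \o s)// derive1_affine.
  by rewrite -scalemxAl mxE.
by have [h _] := sJ 1%N; exact: h.
Qed.

(** A single primitive serves all affine restrictions of the curve, so that additivity of integrals
    becomes a telescoping sum of its values. *)
Lemma path_integral_affine w c : is_one_form S w -> smooth_curve c ->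
  exists G : R -> R, forall a d, 0 <= d <= 1 -> 0 <= a + d <= 1 ->
    path_integral S w (c \o (fun t => a * t + d)) = G (a + d) - G d.
Proof.
move=> hw sc; have cF := integrand_continuous hw sc.
have [G hG] := primitive_exists cF; exists G => a d hd had.
have E := @Rintegral_primitive _ (integrand w (c \o (fun t => a * t + d)))
  (fun t => G (a * t + d)).
rewrite path_integralE; transitivity (G (a * 1 + d) - G (a * 0 + d)); last first.
  by rewrite mulr1 mulr0 add0r.
apply: E.
- apply: integrand_continuous => // t; apply: smooth_at_comp => //; exact: smooth_affine.
- move=> t /andP[t0 t1]; rewrite integrand_affine//.
  have htd : -1 < a * t + d < 2.
    (* A convex combination of the two ends stays in [0, 1], inside the domain of the primitive. *)
    have -> : a * t + d = (1 - t) * d + t * (a + d) by ring.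
    move: hd had => /andP[d0 d1] /andP[a0 a1].
    apply/andP; split.
      by apply: (@lt_le_trans _ _ 0) => //; rewrite addr_ge0 ?mulr_ge0 ?subr_ge0.
    apply: (@le_lt_trans _ _ ((1 - t) * 1 + t * 1)); last by rewrite !mulr1 subrK ltr1n.
    by rewrite lerD// ler_wpM2l// subr_ge0.
  have [dG1 dG2] := hG _ htd.
  have dG : differentiable G (a * t + d) by exact/derivable1_diffP.
  have ds : differentiable (fun t => a * t + d) t by have [h _] := smooth_affine a d 1; exact: h.
  apply: DeriveDef.
    by apply/derivable1_diffP; exact: (differentiable_comp ds dG).
  by rewrite -derive1E (derive1_affine dG) derive1E dG2.
Qed.

(** Agreement is required near each time, endpoints included, because the integrand contains a
    derivative. *)
Lemma path_integral_near_eq w c c' :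
  (forall t : R, 0 <= t <= 1 -> \near t, c t = c' t) ->
  path_integral S w c = path_integral S w c'.
Proof.
move=> cc'; rewrite !path_integralE; apply: eq_Rintegral => t.
rewrite inE /= in_itv /= => /cc' h; rewrite /integrand (nbhs_singleton h).
congr ((_ *m _) 0 0); rewrite !derive1E; apply: near_eq_derive.
by apply: filterS h => s /= ->.
Qed.

(** Over the unit interval the integral equals one value of the integrand, by the mean value theorem
    for a primitive. *)
Lemma path_integral_bound w c (K : R) : is_one_form S w -> smooth_curve c ->
  (forall t : R, 0 <= t <= 1 -> `|integrand w c t| <= K) -> `|path_integral S w c| <= K.
Proof.
move=> hw sc hK; have cF := integrand_continuous hw sc.
have [G hG] := primitive_exists cF.
have hG' (t : R) : 0 <= t <= 1 -> is_derive t 1 G (integrand w c t).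
  by move=> /andP[t0 t1]; apply: hG; apply/andP; split; lra.
rewrite path_integralE (Rintegral_primitive cF hG').
have [||t] := @MVT _ G (integrand w c) 0 1 ltr01.
- by move=> t; rewrite in_itv /= => /andP[t0 t1]; apply: hG'; rewrite !ltW.
- apply: continuous_in_subspaceT => t; rewrite inE /= in_itv /= => /hG'[h _].
  by apply: differentiable_continuous; exact/derivable1_diffP.
- rewrite in_itv /= => /andP[t0 t1] ->; rewrite subr0 mulr1.
  by apply: hK; rewrite !ltW.
Qed.

End Curves.

(** Constancy extends beyond [0, 1] on both sides, so two consecutive paths can be compared on a
    full neighbourhood of their junction. *)
Definition flat_ends (R : realType) (T : Type) (g : R -> T) :=
  exists2 e : R, 0 < e & forall t, (t <= e -> g t = g 0) /\ (1 - e <= t -> g t = g 1).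

Section Joined.
Variables (R : realType) (m : nat) (M Ma : topologicalType) (S : smooth_atlas R m M).
Variable pi : Ma -> M.

(* Being constant near 0 and near 1 makes concatenations of smooth paths smooth. *)
Definition joined_by (x y : Ma) (g : R -> Ma) :=
  [/\ continuous g, smooth_curve S (pi \o g), flat_ends g, g 0 = x & g 1 = y].

Lemma joined_by_cst x : joined_by x x (fun=> x).
Proof.
split => //; first by move=> t; exact: cvg_cst.
- move=> t; exists (chart_at S (pi x)), setT; split => //.
  + exact: chart_at_charts.
  + exact: openT.
  + by move=> _ [s _ <-]; exact: dom_chart_at.
  + by move=> k; exact: (Ck_cst k (cmap (chart_at S (pi x)) (pi x)) openT).
- by exists 1.
Qed.

Lemma joined_by_rev x y g : joined_by x y g -> joined_by y x (g \o (fun t => -1 * t + 1)).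
Proof.
move=> [cg sg [e e0 fg] g0 g1]; split.
- move=> t; apply: continuous_comp; last exact: cg.
  exact: (smooth_affine (-1) 1 0%N t I).
- by move=> t; apply: (@smooth_at_comp _ _ _ _ (pi \o g)) => //; exact: smooth_affine.
- exists e => // t /=; split=> te; rewrite ?mulr0 ?add0r ?mulN1r ?addNr.
    by apply: (fg _).2; lra.
  by apply: (fg _).1; lra.
- by rewrite /= mulr0 add0r.
- by rewrite /= mulr1 addNr.
Qed.

(** The [+ 0] keeps both halves in the form [a * t + d] of the reparametrization lemmas. *)
Definition concat (T : Type) (g1 g2 : R -> T) (t : R) : T :=
  if t < 1 / 2 then g1 (2 * t + 0) else g2 (2 * t + (-1)).

(** Around the junction both halves are constant with the same value, so local properties of a
    concatenation are inherited from just one half. *)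
Lemma concat_near (T : Type) (g1 g2 : R -> T) (t : R) :
  flat_ends g1 -> flat_ends g2 -> g1 1 = g2 0 ->
  (\near t, (g1 \o (fun t => 2 * t + 0)) t = concat g1 g2 t) \/
  (\near t, (g2 \o (fun t => 2 * t + (-1))) t = concat g1 g2 t).
Proof.
move=> [e1 e10 f1] [e2 e20 f2] g12.
have [t2|t2] := ltP t (1 / 2); [left|right].
  apply: (near_open (@open_lt _ (1 / 2))); first exact: t2.
  by move=> s /= s2; rewrite /concat s2.
(* Halved because each half is run at double speed. *)
pose e := Num.min e1 e2 / 2.
have e0 : 0 < e by rewrite divr_gt0// lt_min e10.
have ee1 : 2 * e <= e1 by rewrite mulrC divfK// ge_min lexx.
have ee2 : 2 * e <= e2 by rewrite mulrC divfK// ge_min lexx orbT.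
apply: (near_open (@open_gt _ (1 / 2 - e))); first by rewrite /=; lra.
move=> s /= s2; rewrite /concat; case: ltP => // s1.
rewrite (f2 _).1; last by lra.
by rewrite (f1 _).2 ?g12//; lra.
Qed.

Lemma concat_flat (T : Type) (g1 g2 : R -> T) :
  flat_ends g1 -> flat_ends g2 -> flat_ends (concat g1 g2).
Proof.
move=> [e1 e10 f1] [e2 e20 f2].
pose e := Num.min (Num.min e1 e2 / 2) (1 / 4).
have e0 : 0 < e by rewrite lt_min divr_gt0//= lt_min e10.
have e4 : e <= 1 / 4 by rewrite ge_min lexx orbT.
have ee : e <= Num.min e1 e2 / 2 by rewrite ge_min lexx.
have m1 : Num.min e1 e2 <= e1 by rewrite ge_min lexx.
have m2 : Num.min e1 e2 <= e2 by rewrite ge_min lexx orbT.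
exists e => // t; rewrite /concat; split=> te.
- have h1 : t < 1 / 2 by lra.
  have h0 : (0 : R) < 1 / 2 by lra.
  by rewrite h1 h0 mulr0 !addr0 (f1 _).1//; lra.
- have h1 : (t < 1 / 2) = false by apply/negbTE; rewrite -leNgt; lra.
  have h0 : ((1 : R) < 1 / 2) = false by apply/negbTE; rewrite -leNgt; lra.
  rewrite h1 h0 (f2 (2 * t + _)).2; last by lra.
  by congr g2; lra.
Qed.

Lemma joined_by_concat x y z g1 g2 : joined_by x y g1 -> joined_by y z g2 ->
  joined_by x z (concat g1 g2).
Proof.
move=> [cg1 sg1 fg1 g10 g11] [cg2 sg2 fg2 g20 g21].
have g12 : g1 1 = g2 0 by rewrite g11.
split.
- move=> t; have [h|h] := concat_near t fg1 fg2 g12.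
  + apply: near_eq_continuous_at h _; apply: continuous_comp; last exact: cg1.
    exact: (smooth_affine 2 0 0%N t I).
  + apply: near_eq_continuous_at h _; apply: continuous_comp; last exact: cg2.
    exact: (smooth_affine 2 (-1) 0%N t I).
- move=> t; have [h|h] := concat_near t fg1 fg2 g12.
  + apply: (@smooth_at_near _ _ _ _ ((pi \o g1) \o (fun t => 2 * t + 0))).
      by apply: filterS h => s /= ->.
    by apply: smooth_at_comp => //; exact: smooth_affine.
  + apply: (@smooth_at_near _ _ _ _ ((pi \o g2) \o (fun t => 2 * t + (-1)))).
      by apply: filterS h => s /= ->.
    by apply: smooth_at_comp => //; exact: smooth_affine.
- exact: concat_flat.
- by rewrite /concat ifT ?mulr0 ?addr0//; lra.
- rewrite /concat ifF; last by apply/negbTE; rewrite -leNgt; lra.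
  by rewrite -[RHS]g21; congr g2; lra.
Qed.

(** Each piece is an affine restriction of the concatenation; just past its end the restriction
    enters the flat part of the other piece, so the two agree near every time of [0, 1]. *)
Lemma path_integral_concat w x y z g1 g2 : is_one_form S w ->
  joined_by x y g1 -> joined_by y z g2 ->
  path_integral S w (pi \o concat g1 g2) =
  path_integral S w (pi \o g1) + path_integral S w (pi \o g2).
Proof.
move=> hw j1 j2; have [_ sg _ _ _] := joined_by_concat j1 j2.
move: j1 j2 => [_ _ fg1 _ g11] [_ _ fg2 g20 _].
have [G hG] := path_integral_affine hw sg.
have -> : path_integral S w (pi \o g1) =
    path_integral S w ((pi \o concat g1 g2) \o (fun t => 1 / 2 * t + 0)).
  apply: path_integral_near_eq => t /andP[t0 t1].
  case: fg1 => e1 e10 f1; case: fg2 => e2 e20 f2.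
  apply: (near_open (@open_lt _ (1 + e2))); first by rewrite /=; lra.
  move=> s /= s1; rewrite /concat; case: ltP => h.
    by congr (pi (g1 _)); lra.
  rewrite (f1 s).2; last by lra.
  by rewrite (f2 _).1 ?g11 ?g20//; lra.
have -> : path_integral S w (pi \o g2) =
    path_integral S w ((pi \o concat g1 g2) \o (fun t => 1 / 2 * t + 1 / 2)).
  apply: path_integral_near_eq => t /andP[t0 t1].
  case: fg1 => e1 e10 f1; case: fg2 => e2 e20 f2.
  apply: (near_open (@open_gt _ (- e1))); first by rewrite /=; lra.
  move=> s /= s1; rewrite /concat; case: ltP => h; last first.
    by congr (pi (g2 _)); lra.
  rewrite (f2 s).1; last by lra.
  by rewrite (f1 _).2 ?g11 ?g20//; lra.
have -> : path_integral S w (pi \o concat g1 g2) =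
    path_integral S w ((pi \o concat g1 g2) \o (fun t => 1 * t + 0)).
  by congr (path_integral S w _); apply/funext => t /=; rewrite mul1r addr0.
rewrite !hG; [|lra|lra|lra|lra|lra|lra].
by rewrite !addr0 (_ : 1 / 2 + 1 / 2 = 1); [ring|lra].
Qed.

End Joined.

(** * The universal abelian cover *)

Section Covering.
Variables (X B : topologicalType) (p : X -> B).
Hypothesis hp : covering p.

Lemma covering_open O : open O -> open (p @` O).
Proof.
move=> oO; rewrite openE => _ [x Ox <-].
have [_ _ /(_ (p x))[W [sheets [oW Wx Wsh _ hsh]]]] := hp.
have [V shV Vx] : (\bigcup_(V in sheets) V) x by rewrite -Wsh.
have [oV _ _ hopen] := hsh V shV.
rewrite /interior nbhsE; exists (p @` (O `&` V)).
  split; last by exists x.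
  by apply: hopen; [exact: openI|exact: subIsetr].
by move=> _ [z [Oz _] <-]; exists z.
Qed.

Lemma covering_local_section (u0 : X) : exists (W : set B) (V : set X) (sec : B -> X),
  [/\ open W /\ W (p u0), open V /\ V u0, forall z, W z -> p (sec z) = z,
      forall u, V u -> W (p u) /\ sec (p u) = u & forall z, W z -> {for z, continuous sec}].
Proof.
have [_ _ /(_ (p u0))[W [sheets [oW Wx Wsh _ hsh]]]] := hp.
have [V shV Vx] : (\bigcup_(V in sheets) V) u0 by rewrite -Wsh.
have [oV VW inj hopen] := hsh V shV.
pose sec z := xget u0 [set u | V u /\ p u = z].
have secP z : W z -> V (sec z) /\ p (sec z) = z.
  rewrite -VW => -[u Vu uz]; rewrite /sec; case: xgetP => [v _ //|].
  by move=> /(_ u); case.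
have WV u : V u -> W (p u) by move=> Vu; rewrite -VW; exists u.
have secK u : V u -> sec (p u) = u.
  by move=> Vu; have [? ?] := secP _ (WV _ Vu); exact: inj.
exists W, V, sec; split => //.
- by move=> z /secP[].
- by move=> u Vu; split; [exact: WV|exact: secK].
move=> z Wz A; rewrite nbhsE => -[Q [oQ Qz] QA].
rewrite /= nbhsE; exists (p @` (V `&` Q)).
  split; first by apply: hopen; [exact: openI|exact: subIsetl].
  by have [Vz pz] := secP z Wz; exists (sec z).
by move=> _ [v [Vv Qv] <-] /=; apply: QA; rewrite secK.
Qed.

End Covering.

Lemma deck_commutator_continuous (X B : topologicalType) (p : X -> B) h :
  deck_commutator p h -> continuous h.
Proof.
elim=> [|{}h a a' c c' _ ch [ca [ka cka [aK Ka]] _] a1 a2 [cc [kc ckc [cK Kc]] _] c1 c2] x.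
  exact: cvg_id.
(* Inverses are unique, so [a'] is the continuous inverse provided by [deck p a]. *)
have -> : a' = ka by apply/funext => y; rewrite -{1}[y]Ka a1.
have -> : c' = kc by apply/funext => y; rewrite -{1}[y]Kc c1.
apply: continuous_comp; last exact: ch.
apply: continuous_comp; first exact: ckc.
apply: continuous_comp; first exact: cka.
by apply: continuous_comp; [exact: cc|exact: ca].
Qed.

Section AbelianCover.
Variables (R : realType) (U Ma M : topologicalType) (p : U -> M) (q : U -> Ma) (pi : Ma -> M).
Hypothesis hcover : universal_abelian_cover R p q pi.

Lemma abelian_q_continuous : continuous q.
Proof. by have [_ _ _ h _] := hcover; apply/continuousP => A /h. Qed.

Lemma abelian_pi_continuous : continuous pi.
Proof.
have [[[cp _ _] _] pq _ h _] := hcover; apply/continuousP => A oA; apply/h.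
rewrite (_ : _ @^-1` _ = p @^-1` A); first by move/continuousP: cp; exact.
by apply/funext => u /=; rewrite pq.
Qed.

Lemma abelian_q_open O : open O -> open (q @` O).
Proof.
move=> oO; have [_ _ _ h hq] := hcover; apply/h.
rewrite (_ : _ @^-1` _ = \bigcup_(k in deck_commutator p) (k @^-1` O)).
  apply: bigcup_open => k /deck_commutator_continuous ck.
  by move/continuousP: ck; exact.
apply/seteqP; split => [v [u Ou /esym/hq[k hk uv]]|v [k hk Okv]].
  by exists k => //=; rewrite -uv.
by exists (k v) => //; apply/esym/hq; exists k.
Qed.

Lemma abelian_pi_open O : open O -> open (pi @` O).
Proof.
have [[cov _] pq qs h _] := hcover; move=> oO.
rewrite (_ : pi @` O = p @` (q @^-1` O)).
  by apply: covering_open => //; apply/h.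
apply/seteqP; split => [_ [x Ox <-]|_ [u Ou <-]].
  by have [u ux] := qs x; exists u; rewrite -?pq /= ?ux.
by exists (q u).
Qed.

Variables (m : nat) (S : smooth_atlas R m M).

(** Segments of a chart, run along the smooth step to be flat at the ends and lifted through a local
    section, reach all points near x; their integrals are bounded by speed times the size of the
    forms. *)
Lemma local_paths b (w : 'I_b -> one_form R m M) (x : Ma) :
  (forall i, is_one_form S (w i)) ->
  exists (N : set Ma) (K : R), [/\ open N, N x &
    forall x', N x' -> exists2 g, joined_by S pi x x' g &
      forall i, `|path_integral S (w i) (pi \o g)| <= K].
Proof.
move=> hw; have [[cov sc] pq qs hq _] := hcover.
have [u0 u0x] := qs x.
have [W [V [sec [[oW Wy] [oV Vu0] secK Ksec csec]]]] := covering_local_section cov u0.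
set y := p u0 in Wy.
pose phi := chart_at S y; pose a := cmap phi y.
have dy : dom phi y by exact: dom_chart_at.
have ca : cod phi a by exists y.
have hphi : charts S phi by exact: chart_at_charts.
have [s [ss s0 s1 s01]] := smooth_step_exists R.
have cds : continuous (derive1 s).
  have /CkSP[|_ h] := ss 1%N; first exact: openT.
  by move=> t; exact: (h t I).
have [Ks hKs] : exists Ks : R, forall t : R, 0 <= t <= 1 -> `|derive1 s t| <= Ks.
  have [|t _ ht] := @EVT_max R (fun t => `|derive1 s t|) 0 1 ler01.
    by apply: continuous_subspaceT => t; apply: cvg_norm; exact: cds.
  exists `|derive1 s t| => t' ht'; apply: ht; by rewrite in_itv.
(* In A the local section is defined and the coefficients of the forms exceed those at [a] by at
   most 1. A ball inside A contains the whole segment from its centre to each of its points. *)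
pose A := [set u | [/\ cod phi u, W (cinv phi u) &
  forall i j, `|w i phi u j 0| <= `|w i phi a j 0| + 1]].
have nA : nbhs a A.
  have n1 : nbhs a (cod phi) by apply: open_nbhs_nbhs; split => //; exact: cod_open.
  have n2 : nbhs a (cinv phi @^-1` W).
    apply: (cinv_continuous ca); rewrite /a cmapK//.
    exact: open_nbhs_nbhs.
  have n3 : nbhs a [set u | forall i j, `|w i phi u j 0| <= `|w i phi a j 0| + 1].
    apply: (@filter_forall _ _ _ (nbhs a) (nbhs_filter a)) => i.
    apply: (@filter_forall _ _ _ (nbhs a) (nbhs_filter a)) => j.
    have cw : {for a, continuous (w i phi)} by apply: ((hw i).1 _ hphi 0%N).
    have c1 : (fun u => w i phi u j 0) @ a --> w i phi a j 0.
      exact: (continuous_comp cw (@coord_continuous R m 1 j 0 _)).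
    have H1 : `|w i phi a j 0| < `|w i phi a j 0| + 1 by rewrite ltrDl.
    exact: (cvgr_norm_le _ c1 _ H1).
  by apply: filterS (filterI n1 (filterI n2 n3)) => u [? []].
have [r r0 rA] : exists2 r : R, 0 < r & ball a r `<=` A.
  by move/nbhs_ballP: nA => [r r0 h]; exists r.
pose N0 := V `&` p @^-1` (dom phi `&` cmap phi @^-1` ball a r).
have oN0 : open N0.
  apply: openI => //; have [cp _ _] := cov; move/continuousP: cp; apply.
  rewrite openE => z [dz bz]; rewrite /interior.
  apply: filterI; first by apply: open_nbhs_nbhs; split => //; exact: dom_open.
  apply: (cmap_continuous dz); apply: open_nbhs_nbhs; split => //.
  exact: ball_open.
(* [Ks] bounds the derivative of the step, [r] the length of the segment, and the last factor the
   coefficients; summing over i gives one bound for all forms. *)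
exists (q @` N0), (\sum_i \sum_j Ks * (r * (`|w i phi a j 0| + 1))); split.
- exact: abelian_q_open.
- exists u0 => //; split => //; split => //; exact: ballxx.
move=> _ [u' [Vu' [du' bu']] <-].
pose v := cmap phi (p u'); pose l (t : R) := a + s t *: (v - a).
have lA t : A (l t).
  apply: rA; rewrite -ball_normE /= /l opprD addNKr normrN normrZ.
  have /andP[st0 st1] := s01 t; rewrite (ger0_norm st0).
  have av : `|v - a| < r by move: bu'; rewrite -ball_normE /= distrC.
  apply: le_lt_trans av; by rewrite ler_piMl.
pose c t := cinv phi (l t); pose g := q \o sec \o c.
have pg : pi \o g = c.
  by apply/funext => t; rewrite /g /= pq secK//; have [_ + _] := lA t.
have codK u : cod phi u -> dom phi (cinv phi u) /\ cmap phi (cinv phi u) = u.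
  by move=> [z dz <-]; rewrite cmapK.
have dc t : dom phi (c t) by have [/codK[]] := lA t.
have pc : cmap phi \o c = l by apply/funext => t /=; have [/codK[]] := lA t.
have sl : smooth_on setT l.
  move=> k; apply/Ck_rowP => [|j]; first exact: openT.
  have := CkD openT (Ck_cst k (a 0 j) openT) (Ck_scale ((v - a) 0 j) openT (ss k)).
  apply: Ck_ext => [|t _]; first exact: openT.
  by rewrite /l !mxE [_ *: _]mulrC.
have Jc : c @` setT `<=` dom phi by move=> _ [t _ <-].
have scv : smooth_curve S c.
  by move=> t; exists phi, setT; split => //; [exact: openT|rewrite pc].
exists g.
  split.
  + move=> t; apply: (@continuous_comp _ _ _ (sec \o c) q); last exact: abelian_q_continuous.
    apply: continuous_comp; first exact: (smooth_at_continuous (scv t)).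
    by apply: csec; have [] := lA t.
  + by rewrite pg.
  + exists (1 / 4); first lra; move=> t; rewrite /g /c /l /=; split=> ht.
      by rewrite !s0//; lra.
    by rewrite !s1//; lra.
  + rewrite /g /c /l /= s0 ?scale0r ?addr0; last lra.
    by rewrite /a cmapK// (Ksec _ Vu0).2.
  + rewrite /g /c /l /= s1 ?scale1r ?(addrC a) ?subrK; last lra.
    by rewrite /v cmapK// (Ksec _ Vu').2.
move=> i; rewrite pg.
apply: (@le_trans _ _ (\sum_j Ks * (r * (`|w i phi a j 0| + 1)))); last first.
  have Ks0 : 0 <= Ks by apply: le_trans (hKs 0 _); rewrite ?lexx ?ler01.
  rewrite [leRHS](bigD1 i)//= lerDl; apply: sumr_ge0 => i' _; apply: sumr_ge0 => j _.
  by rewrite mulr_ge0// mulr_ge0 ?(ltW r0)// addr_ge0.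
apply: path_integral_bound => // t t01.
rewrite (integrand_chart (hw i) hphi openT I Jc) pc//.
rewrite mxE; apply: le_trans (ler_norm_sum _ _ _) _.
apply: ler_sum => j _; rewrite normrM -[cmap phi (c t)]/((cmap phi \o c) t) pc.
have dl : derivable l t 1.
  by have /CkSP[|h _] := sl 1%N; [exact: openT|exact: h].
have -> : derive1 l t 0 j = derive1 s t * (v - a) 0 j.
  rewrite derive1E derive_mx// mxE.
  have ds : derivable s t 1.
    by have /CkSP[|h _] := ss 1%N; [exact: openT|exact: h].
  rewrite (_ : (fun _ => _) = cst (a 0 j) + ((v - a) 0 j) *: s); last first.
    by apply/funext => t'; rewrite /l !mxE [s t' * _]mulrC.
  rewrite deriveD//; last exact: derivableZ.
  by rewrite derive_cst add0r deriveZ// derive1E mulrC.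
rewrite normrM -mulrA; apply: ler_pM => //; first exact: hKs.
apply: ler_pM => //; last by have [_ _] := lA t; exact.
have av : `|v - a| < r by move: bu'; rewrite -ball_normE /= distrC.
apply: le_trans (ltW av).
rewrite [leRHS]/Num.norm /= mx_normrE.
by apply/bigmax_geP; right; exists (0, j).
Qed.

(** The points of U whose images are smoothly reachable form an open and closed set. A continuous
    path of the simply connected U, having connected image, cannot leave it. *)
Lemma joined_all x y : exists g, joined_by S pi x y g.
Proof.
have [[_ [pathU _]] _ qs _ _] := hcover.
have [u ux] := qs x; have [v vy] := qs y; rewrite -ux -vy.
pose E := [set z | exists g, joined_by S pi (q u) (q z) g].
have near_joined z : exists N : set U, [/\ open N, N z &
    forall z', N z' -> exists g, joined_by S pi (q z) (q z') g].
  (* Only the paths matter here, so the family of forms is taken empty. *)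
  have [N [K [oN Nz hN]]] := @local_paths 0 (fun _ _ _ => 0) (q z)
    (fun i => False_ind _ (notF (ltn_ord i))).
  exists (q @^-1` N); split => //.
    by have /continuousP := abelian_q_continuous; exact.
  by move=> z' /hN[g jg _]; exists g.
have oE : open E.
  rewrite openE => z [g jg]; have [N [oN Nz hN]] := near_joined z.
  rewrite /interior nbhsE; exists N => // z' /hN[g' jg'].
  by exists (concat g g'); exact: joined_by_concat jg jg'.
have cE : closed E.
  rewrite -openC openE => z nEz; have [N [oN Nz hN]] := near_joined z.
  rewrite /interior nbhsE; exists N => // z' /hN[g' jg'] [g jg]; apply: nEz.
  by eexists; exact: joined_by_concat jg (joined_by_rev jg').
have [gam [cgam g0 g1]] := pathU u v.
have cI : connected (gam @` `[0, 1]%classic).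
  apply: connected_continuous_connected cgam; exact: segment_connected.
have Iu : (gam @` `[0, 1]%classic) u by exists 0; rewrite //= in_itv /= lexx ler01.
have Iv : (gam @` `[0, 1]%classic) v by exists 1; rewrite //= in_itv /= lexx ler01.
have h : (gam @` `[0, 1]%classic) `&` E = gam @` `[0, 1]%classic.
  apply: cI.
  - by exists u; split => //; eexists; exact: joined_by_cst.
  - by exists E.
  - by exists E.
by move: Iv; rewrite -h => -[].
Qed.

End AbelianCover.

(** * Deck transformations, equivariance and integration *)

Section DeckAction.
Variables (R : realType) (m b : nat) (M U Ma : topologicalType).
Variables (S : smooth_atlas R m M) (Gamma : 'I_b -> chain R 1 M).
Variables (p : U -> M) (q : U -> Ma) (pi : Ma -> M) (delta : 'cV[int]_b -> Ma -> Ma).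
Hypothesis hcover : universal_abelian_cover R p q pi.
Hypothesis hdelta : deck_iso pi Gamma delta.

Lemma deck_pi n x : pi (delta n x) = pi x.
Proof. by have [[h _] _ _ _] := hdelta; have [_ _] := h n; exact. Qed.

Lemma deck0 x : delta 0 x = x.
Proof.
have [[h _] hD _ _] := hdelta; have [_ [k _ [hk _]] _] := h 0.
by rewrite -[LHS]hk -hD addr0 hk.
Qed.

Lemma deck_path n x : exists g, joined_by S pi x (delta n x) g /\
  homologous (path_chain (pi \o g)) (lin_comb n Gamma).
Proof.
have [g jg] := joined_all hcover S x (delta n x); exists g; split => //.
have [cg _ _ g0 g1] := jg; have [_ _ _ h] := hdelta.
by apply: h g0 g1; exact: continuous_subspaceT.
Qed.

(** Both points lie over the same point, so they differ by some [delta k]. The loop below the image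
    of a path from x to [delta n x] has class k by [deck_iso] and class A n by pushing forward with
    f; uniqueness of coordinates gives k = A n. *)
Lemma deck_equivariant (f : M -> M) (tf : Ma -> Ma) (A : 'M[int]_b) :
  homology_basis Gamma -> continuous f -> continuous tf ->
  (forall x, pi (tf x) = f (pi x)) -> induces Gamma f A ->
  forall n x, tf (delta n x) = delta (A *m n) (tf x).
Proof.
move=> [_ hbasis] cf ctf lift hA n x.
have [g [[cg sg _ g0 g1] hg]] := deck_path n x.
have [_ _ hfib hpath] := hdelta.
have [|k hk] := hfib (tf x) (tf (delta n x)); first by rewrite !lift deck_pi.
rewrite hk; congr (delta _ _).
have ctg : continuous (tf \o g).
  by move=> t; apply: continuous_comp; [exact: cg|exact: ctf].
have hz1 : homologous (path_chain (pi \o (tf \o g))) (lin_comb k Gamma).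
  apply: (hpath k (tf x)); first exact: continuous_subspaceT.
    by rewrite /= g0.
  by rewrite /= g1.
have fE : pi \o (tf \o g) = f \o (pi \o g) by apply/funext => t; exact: lift.
have hz2 : homologous (path_chain (pi \o (tf \o g))) (lin_comb (A *m n) Gamma).
  rewrite fE; apply: homologous_trans (push_homologous cf hg) _.
  rewrite push_lin_comb.
  apply: homologous_trans (homologous_lin_comb n hA) _.
  exact: lin_comb_mul.
have cz : is_cycle (path_chain (pi \o (tf \o g))).
  apply: path_chain_cycle => [t|].
    by apply: continuous_comp; [exact: ctg|exact: (abelian_pi_continuous hcover)].
  by rewrite /= g0 g1 !lift deck_pi.
by have [l [_ ul]] := hbasis _ cz; rewrite -(ul _ hz1) -(ul _ hz2).
Qed.

Variables (w : 'I_b -> one_form R m M) (x0 : Ma) (iota : Ma -> 'cV[R]_b).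
Hypothesis hw : forall i, is_one_form S (w i).
Hypothesis hiota : is_iota S w pi x0 iota.

(** [is_iota] covers only paths from [x0]: a path from [x0] to x is put in front. *)
Lemma iota_joined x y g i : joined_by S pi x y g ->
  iota y i 0 = iota x i 0 + path_integral S (w i) (pi \o g).
Proof.
move=> jg; have [g0 jg0] := joined_all hcover S x0 x.
have iotaE z h : joined_by S pi x0 z h -> iota z i 0 = path_integral S (w i) (pi \o h).
  move=> [ch sh _ h0 h1]; apply: hiota => //; first exact: continuous_subspaceT.
  exact: smooth_curve_path.
rewrite (iotaE _ _ jg0) (iotaE _ _ (joined_by_concat jg0 jg)).
exact: path_integral_concat (hw i) jg0 jg.
Qed.

Lemma iota_locally_bounded x : exists (N : set Ma) (K : R), [/\ open N, N x &
  forall x', N x' -> `|iota x'| <= K].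
Proof.
have [N [K [oN Nx hN]]] := local_paths hcover (w := w) x hw.
exists N, (`|iota x| + `|K|); split => // x' /hN[g jg hg].
apply: mx_norm_le => [|i j]; first by rewrite addr_ge0.
rewrite (ord1 j) (iota_joined i jg); apply: le_trans (ler_normD _ _) _.
apply: lerD; first exact: mx_norm_entry.
exact: le_trans (hg i) (ler_norm K).
Qed.

Hypothesis hdual : dual_to S w Gamma.

Lemma iota_delta n x : iota (delta n x) = iota x + mxR R n.
Proof.
have [_ hD _ _] := hdelta.
(* [dual_to] evaluates only loops homologous to a single [Gamma j]. The vectors n with the property
   form a subgroup, so unit vectors suffice. *)
pose P n := forall x, iota (delta n x) = iota x + mxR R n.
have P0 : P 0 by move=> y; rewrite deck0 /mxR map_mx0 addr0.
have PD k l : P k -> P l -> P (k + l).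
  by move=> Pk Pl y; rewrite hD Pk Pl /mxR map_mxD -addrA [_ + map_mx _ l]addrC.
have PN k : P k -> P (- k).
  move=> Pk y; rewrite -{2}[y]deck0 -(subrr k) hD Pk /mxR map_mxN.
  by rewrite addrK.
have Pdelta j : P (delta_mx j 0).
  move=> y; have [g [jg hg]] := deck_path (delta_mx j 0) y.
  have [_ sg _ g0 g1] := jg.
  apply/colP => i; rewrite (iota_joined i jg) !mxE; congr (_ + _).
  rewrite (hdual i (smooth_curve_path sg) _ (homologous_trans hg (lin_comb_delta _ _))).
    by rewrite andbT; case: (i == j).
  by rewrite /= g0 g1 deck_pi.
have Pmuln k l : P k -> P (k *+ l).
  by move=> Pk; elim: l => [|l IH]; [rewrite mulr0n|rewrite mulrS; exact: PD].
suff : P n by [].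
rewrite (matrix_sum_delta n); elim/big_ind: _ => // i _.
elim/big_ind: _ => // j _; rewrite (ord1 j); case: (n i 0) => a.
  by rewrite -[Posz a]natz scaler_nat; exact: Pmuln.
by rewrite NegzE scaleNr -[Posz _]natz scaler_nat; apply: PN; exact: Pmuln.
Qed.

Lemma iota_lift_bounded (f : M -> M) (tf : Ma -> Ma) (A : 'M[int]_b) :
  compact [set: M] -> homology_basis Gamma -> continuous f -> continuous tf ->
  (forall x, pi (tf x) = f (pi x)) -> induces Gamma f A ->
  exists C, forall x, `|iota (tf x) - mxR R A *m iota x| <= C.
Proof.
move=> cM hG cf ctf lift hA.
pose D x := iota (tf x) - mxR R A *m iota x.
have Ddelta n x : D (delta n x) = D x.
  rewrite /D (deck_equivariant hG cf ctf lift hA) !iota_delta mulmxDr.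
  by rewrite /mxR map_mxM opprD addrACA subrr addr0.
(* NOOP *)
have [_ _ hfib _] := hdelta.
have Dfib x y : pi x = pi y -> D x = D y by move=> /hfib[n ->].
have Dloc y : exists (N : set M) (K : R), [/\ open N, N y &
    forall x, N (pi x) -> `|D x| <= K].
  have [[_ _] pq qs _ _] := hcover; have [[[_ ps _] _] _ _ _ _] := hcover.
  have [u uy] := ps y; pose x := q u.
  have [N1 [K1 [oN1 N1x h1]]] := iota_locally_bounded x.
  have [N2 [K2 [oN2 N2x h2]]] := iota_locally_bounded (tf x).
  exists (pi @` (N1 `&` tf @^-1` N2)), (K2 + b%:R * `|mxR R A| * K1); split.
  - apply: (abelian_pi_open hcover); apply: openI => //.
    by move/continuousP: ctf; exact.
  - by exists x; rewrite // pq.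
  move=> x' [z [N1z N2z] /Dfib <-]; rewrite /D.
  apply: le_trans (ler_normB _ _) _; apply: lerD; first exact: h2.
  apply: le_trans (mx_norm_mul _ _) _; rewrite ler_wpM2l//.
  exact: h1.
have : \forall K \near +oo, [set: M] `<=` [set y | forall x, pi x = y -> `|D x| <= K].
  move/compact_near_coveringP: cM; apply => y _.
  have [N [K [oN Ny hN]]] := Dloc y.
  exists (N, [set K' | K <= K']).
    by split => /=; [exact: open_nbhs_nbhs|apply: nbhs_pinfty_ge; exact: num_real].
  move=> [z K'] /= [Nz KK'] x xz; apply: le_trans KK'; apply: hN; by rewrite xz.
move=> [K [_ hK]]; exists (K + 1) => x.
by apply: (hK (K + 1) _ (pi x)) => //; rewrite ltrDl.
Qed.

End DeckAction.

Theorem lemma9p1 (R : realType) (m b : nat) (M U Ma : topologicalType)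
  (S : smooth_atlas R m M) (g : metric_tensor R m M)
  (Gamma : 'I_b -> chain R 1 M) (w : 'I_b -> one_form R m M)
  (f : M -> M) (A : 'M[int]_b)
  (p : U -> M) (q : U -> Ma) (pi : Ma -> M)
  (delta : 'cV[int]_b -> Ma -> Ma) (tf : Ma -> Ma)
  (x0 : Ma) (iota : Ma -> 'cV[R]_b)
  (M0 : set Ma) (fl : Ma -> 'cV[int]_b)
  (hM_hausdorff : hausdorff_space M)
  (hM_compact : compact [set: M])
  (hM_connected : connected [set: M])
  (hM_orientable : orientable S)
  (hg : is_riemannian S g)
  (hb : (0 < b)%N)
  (hGamma : homology_basis Gamma)
  (hw_harmonic : forall i, harmonic_form S g (w i))
  (hw_basis : deRham_basis S w)
  (hw_dual : dual_to S w Gamma)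
  (hf_continuous : continuous f)
  (hf_onto : forall y, exists x, f x = y)
  (hf_orientation : orientation_preserving R m f)
  (hA : induces Gamma f A)
  (hA_expanding : H1_expanding R A)
  (hcover : universal_abelian_cover R p q pi)
  (hdelta : deck_iso pi Gamma delta)
  (htf_continuous : continuous tf)
  (htf_lift : forall x, pi (tf x) = f (pi x))
  (hiota : is_iota S w pi x0 iota)
  (hM0 : fundamental_domain delta M0)
  (hM0_bounded : bounded_set (iota @` M0))
  (hfl : is_integer_part delta M0 fl) :
  forall x : Ma,
    (fun k : nat => invmx (mxR R A ^+ k - 1%:M)
                      *m mxR R (displacement fl tf k x)) @ \oo
      --> tbeta A iota tf x.
Proof.
have hw i : is_one_form S (w i) by have [[]] := hw_harmonic i.
have [C1 hC1] := iota_lift_bounded hcover hdelta hw hiota hw_dual hM_compact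
  hGamma hf_continuous htf_continuous htf_lift hA.
have [C2 hC2] : exists C, forall x, `|iota x - mxR R (fl x)| <= C.
  case: hM0_bounded => K [_ hK]; exists (K + 1) => x.
  have [z M0z zx] := hfl x.
  rewrite -{1}zx (iota_delta hcover hdelta hw hiota hw_dual) addrK.
  by apply: (hK (K + 1)); [rewrite ltrDl|exists z].
move=> {hGamma hw_harmonic hw_basis hw_dual hA hdelta hM0 hfl hM0_bounded hiota hw}.
case: b hb A iota fl hA_expanding hC1 hC2 {w Gamma delta} => // n _ A' iota' fl' hA' hC1 hC2 x.
apply: (@displacement_limit R n A' hA' Ma iota' tf fl' (Num.max C1 C2)) => y.
  by rewrite le_max hC1.
by rewrite le_max hC2 orbT.
Qed.
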